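(* Let $\varphi:\mathbb{D}\to\mathbb{C}$ be an analytic univalent function with positive real part in $\mathbb{D}$, with $\varphi(0)=1$, $\varphi'(0)>0$ and $\varphi''(0)\in\mathbb{R}$, and write $\varphi(z)=1+B_1z+B_2z^2+\cdots$. Suppose that $B_1>0$ and $B_1-B_1^2\le B_2\le 3B_1^2-B_1$. Then every $f\in\mathcal{S}^*(\varphi)$ satisfies $$|T_3(1)|\le 1+2B_1^2+\frac14\,(B_2+B_1^2)(3B_1^2-B_2),$$ where $T_3(1)$ is the Toeplitz determinant of $f$. The bound is sharp, i.e. for each such $\varphi$ there is a function $f\in\mathcal{S}^*(\varphi)$ for which equality holds.
   Context: $\mathbb{D}$ is the open unit disk in $\mathbb{C}$. $\mathcal{A}$ is the class of analytic functions $f:\mathbb{D}\to\mathbb{C}$ with Taylor series $f(z)=z+\sum_{n\ge2}a_nz^n$, and $\mathcal{S}\subset\mathcal{A}$ is the subclass of univalent (one-to-one) functions. For analytic functions $g,F$ on $\mathbb{D}$, $g$ is subordinate to $F$, written $g\prec F$, if there is an analytic $w:\mathbb{D}\to\mathbb{D}$ with $w(0)=0$ such that $g(z)=F(w(z))$ for all $z\in\mathbb{D}$. The class $\mathcal{S}^*(\varphi)$ is $$\mathcal{S}^*(\varphi):=\left\{f\in\mathcal{S}:\ \frac{zf'(z)}{f(z)}\prec\varphi(z)\right\}.$$ (The quotient $zf'(z)/f(z)$ is given the value $1$ at $z=0$.) For $f(z)=z+\sum_{n\ge2}a_nz^n$ (so $a_1=1$), $T_q(n)$ denotes the determinant of the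 $q\times q$ symmetric Toeplitz matrix whose $(i,j)$ entry is $a_{n+|i-j|}$; in particular $$T_3(1)=\begin{vmatrix} 1 & a_2 & a_3 \\ a_2 & 1 & a_2 \\ a_3 & a_2 & 1 \end{vmatrix}.$$ *)

(* Defs.v *)
From Stdlib Require Import Reals Factorial.
From Coquelicot Require Import Coquelicot.

Open Scope C_scope.

Definition in_disk (z : C) : Prop := (Cmod z < 1)%R.

(* Functions on the unit disk are total functions C -> C whose values outside
   the disk are irrelevant: every condition below only looks at the disk, and
   the disk being open, complex derivatives at its points depend only on the
   values there. *)
Definition analytic_on_disk (f : C -> C) : Prop :=
  forall z : C, in_disk z -> @ex_derive C_AbsRing C_NormedModule f z.

Definition univalent_on_disk (f : C -> C) : Prop :=
  forall z1 z2 : C, in_disk z1 -> in_disk z2 -> f z1 = f z2 -> z1 = z2.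

Definition C_derive_n (n : nat) (f : C -> C) : C -> C := Nat.iter n C_derive f.

Definition taylor_coef (f : C -> C) (n : nat) : C :=
  C_derive_n n f 0 / RtoC (INR (fact n)).

Definition class_A (f : C -> C) : Prop :=
  analytic_on_disk f /\ taylor_coef f 0 = 0 /\ taylor_coef f 1 = 1.

Definition class_S (f : C -> C) : Prop :=
  class_A f /\ univalent_on_disk f.

Definition subordinate (g F : C -> C) : Prop :=
  exists w : C -> C,
    analytic_on_disk w /\
    (forall z : C, in_disk z -> in_disk (w z)) /\
    w 0 = 0 /\
    (forall z : C, in_disk z -> g z = F (w z)).

(* z f'(z) / f(z), with its removable singularity at 0 filled in. *)
Definition starlike_quotient (f : C -> C) (z : C) : C :=
  if Ceq_dec z 0 then 1 else z * C_derive f z / f z.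

Definition class_S_star (phi f : C -> C) : Prop :=
  class_S f /\ subordinate (starlike_quotient f) phi.

(* Determinant of (M i j) for i, j < n, by Laplace expansion along row 0. *)
Fixpoint det (n : nat) (M : nat -> nat -> C) : C :=
  match n with
  | O => 1
  | S m =>
      sum_n (fun j : nat =>
        (- (1)) ^ j * M O j *
        det m (fun i k : nat => M (S i) (if Nat.ltb k j then k else S k))) m
  end.

(* The natural number (i - j) + (j - i), with truncated subtraction,
   is |i - j|. *)
Definition toeplitz_det (f : C -> C) (q n : nat) : C :=
  det q (fun i j : nat => taylor_coef f (n + ((i - j) + (j - i)))).

(* Main.v *)
Require Import Defs.
From Stdlib Require Import Reals Factorial Lra.
From Coquelicot Require Import Coquelicot.

(** The quantity [a_2] equals [B1 c_1] and [a_3] equals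
    [(B1 c_2 + (B2 + B1^2) c_1^2) / 2], where [w = c_1 z + c_2 z^2 + ...] is the
    Schwarz function of the subordination.  Since
    [T_3(1) = 1 - 2 a_2^2 + a_3 (2 a_2^2 - a_3)] and [|c_2| <= 1 - |c_1|^2], the
    hypotheses on [B1, B2] bound [|a_3|] by [(B2 + B1^2) / 2] and
    [|a_3 - 2 a_2^2|] by [(3 B1^2 - B2) / 2].  Equality holds for [w = i z], that
    is for [f = z exp G] with [G' = (phi (i z) - 1) / z].  In the coordinate
    [z = exp s], [log f = s + G (exp s)] has derivative [phi (i exp s)] of positive
    real part on a half-plane, so [f] is univalent by the Noshiro-Warschawski
    argument and the [2 pi i]-periodicity of [exp].

    Complex differentiability alone gives smoothness through Goursat's lemma: a
    function continuous on the disk and differentiable off one point has a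
    primitive, and applied to a difference quotient this yields Cauchy's formula. *)

Open Scope R_scope.

(** * Complex differentiation *)

(** Put x = |c_1|^2. Both a_3 and a_3 - 2 a_2^2 have the shape (B1 c_2 + q c_1^2) / 2, with q = B2 +
    B1^2 and q = B2 - 3 B1^2, so their moduli are at most (B1 (1 - x) + |q| x) / 2. This is affine
    in x, and the two hypotheses on B2 amount to B2 + B1^2 >= B1 and 3 B1^2 - B2 >= B1, which put
    the maximum at x = 1. A rotation w attains x = 1. Among rotations, the choice c_1^2 = -1 makes -
    2 a_2^2 positive and gives a_3 and 2 a_2^2 - a_3 the same sign, so nothing cancels in the
    triangle inequality.

    The obstacle is that Taylor coefficients are iterated derivatives, whereas analyticity grants a
    single derivative at each point of the disk. The third derivative of f, the removable
    singularity of (phi (i z) - 1) / z and the bound on c_2 are therefore all drawn from integrals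
    over circles, which in turn rest on real integrals of the two components. *)

Notation is_Cderive f z l := (@is_derive C_AbsRing C_NormedModule f z l).

(** Neighbourhoods in the domain are discs for [Cmod] and the norm of the target is [Cmod], so the
    little-o condition unfolds to this one directly. *)
Lemma is_Cderive_eps (f : C -> C) (z l : C) :
  is_Cderive f z l <->
  (forall eps : R, 0 < eps -> exists delta : R, 0 < delta /\
     forall y : C, Cmod (y - z) < delta ->
       Cmod (f y - f z - (y - z) * l) <= eps * Cmod (y - z)).
Proof.
  split.
  - intros [_ H] eps He.
    destruct (H z (fun P HP => HP) (mkposreal eps He)) as [d Hd].
    exists (pos d); split; [apply cond_pos|].
    intros y Hy; apply (Hd y), Hy.
  - intros H; split; [apply is_linear_scal_l|].
    intros x Hx eps.
    assert (E : z = x) by (apply (is_filter_lim_locally_unique (K := C_AbsRing) (V := AbsRing_NormedModule C_AbsRing)), Hx).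
    subst x.
    destruct (H eps (cond_pos eps)) as [d [Hd Hy]].
    exists (mkposreal d Hd); intros y By; apply (Hy y), By.
Qed.

(** Here C is a real normed space with the product norm, which [Cmod_norm] identifies with
    [Cmod]. *)
Lemma is_derive_curve_eps (g : R -> C) (t : R) (l : C) :
  @is_derive R_AbsRing C_R_NormedModule g t l <->
  (forall eps : R, 0 < eps -> exists delta : R, 0 < delta /\
     forall s : R, Rabs (s - t) < delta ->
       Cmod (g s - g t - RtoC (s - t) * l) <= eps * Rabs (s - t)).
Proof.
  assert (E : forall s, minus (minus (g s) (g t)) (scal (s - t) l) = (g s - g t - RtoC (s - t) * l)%C).
  { intros s. destruct (g s), (g t), l. unfold minus, plus, opp, scal; simpl.
    unfold prod_plus, prod_opp, prod_scal, scal, plus, opp; simpl. unfold mult; simpl.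
    unfold Cminus, Cplus, Copp, Cmult, RtoC; simpl. f_equal; ring. }
  split.
  - intros [_ H] eps He.
    destruct (H t (fun P HP => HP) (mkposreal eps He)) as [d Hd].
    exists (pos d); split; [apply cond_pos|].
    intros s Hs. specialize (Hd s Hs). rewrite Cmod_norm, <- E. exact Hd.
  - intros H; split; [apply is_linear_scal_l|].
    intros x Hx eps.
    assert (E' : t = x) by (apply (is_filter_lim_locally_unique (K := R_AbsRing) (V := R_NormedModule)), Hx).
    subst x.
    destruct (H eps (cond_pos eps)) as [d [Hd Hy]].
    exists (mkposreal d Hd); intros s Bs.
    specialize (Hy s Bs). rewrite Cmod_norm, <- E in Hy. exact Hy.
Qed.

(** C carries two normed-module structures over itself. Product and chain rules speak of the ring as
    a module over itself, and the derivative condition is the same for both. *)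
Lemma is_Cderive_AbsRing (f : C -> C) (z l : C) :
  is_Cderive f z l <-> @is_derive C_AbsRing (AbsRing_NormedModule C_AbsRing) f z l.
Proof.
  split; intros [_ H]; (split; [apply is_linear_scal_l | exact H]).
Qed.

Lemma is_Cderive_mult (f g : C -> C) (z lf lg : C) :
  is_Cderive f z lf -> is_Cderive g z lg ->
  is_Cderive (fun x => f x * g x)%C z (lf * g z + f z * lg)%C.
Proof.
  intros Hf%is_Cderive_AbsRing Hg%is_Cderive_AbsRing.
  apply is_Cderive_AbsRing.
  apply (is_derive_mult f g); auto.
  intros n m; apply Cmult_comm.
Qed.

Lemma is_Cderive_comp (f g : C -> C) (z lf lg : C) :
  is_Cderive f (g z) lf -> is_Cderive g z lg ->
  is_Cderive (fun x => f (g x)) z (lg * lf)%C.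
Proof.
  intros Hf Hg%is_Cderive_AbsRing.
  apply (is_derive_comp f g); auto.
Qed.

Lemma is_Cderive_plus (f g : C -> C) (z lf lg : C) :
  is_Cderive f z lf -> is_Cderive g z lg ->
  is_Cderive (fun x => f x + g x)%C z (lf + lg)%C.
Proof. apply (is_derive_plus (K := C_AbsRing) (V := C_NormedModule)). Qed.

Lemma is_Cderive_minus (f g : C -> C) (z lf lg : C) :
  is_Cderive f z lf -> is_Cderive g z lg ->
  is_Cderive (fun x => f x - g x)%C z (lf - lg)%C.
Proof. apply (is_derive_minus (K := C_AbsRing) (V := C_NormedModule)). Qed.

Lemma is_Cderive_const (c z : C) : is_Cderive (fun _ => c) z (RtoC 0).
Proof. apply (is_derive_const (K := C_AbsRing) (V := C_NormedModule)). Qed.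

Lemma is_Cderive_id (z : C) : is_Cderive (fun x => x) z (RtoC 1).
Proof. apply is_Cderive_AbsRing, (is_derive_id (K := C_AbsRing)). Qed.

Lemma is_Cderive_scal (c : C) (f : C -> C) (z l : C) :
  is_Cderive f z l -> is_Cderive (fun x => c * f x)%C z (c * l)%C.
Proof.
  intros H. replace (c * l)%C with (RtoC 0 * f z + c * l)%C by ring.
  apply is_Cderive_mult; [apply is_Cderive_const | exact H].
Qed.

Lemma is_Cderive_ext_near (f g : C -> C) (z l : C) (r : R) :
  0 < r -> (forall y : C, Cmod (y - z) < r -> f y = g y) ->
  is_Cderive f z l -> is_Cderive g z l.
Proof.
  intros Hr E. apply is_derive_ext_loc.
  exists (mkposreal r Hr). exact E.
Qed.

Lemma is_Cderive_eq (f : C -> C) (z l l' : C) :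
  is_Cderive f z l -> l = l' -> is_Cderive f z l'.
Proof. intros H <-; exact H. Qed.

Lemma is_Cderive_Cinv (z : C) :
  z <> RtoC 0 -> is_Cderive Cinv z (- / (z * z))%C.
Proof.
  intros Hz. apply is_Cderive_eps. intros eps He.
  assert (Hm : 0 < Cmod z) by (apply Cmod_gt_0, Hz).
  (* The first radius gives |y| >= |z| / 2, hence |y| |z|^2 >= |z|^3 / 2. The second makes the
     remainder (y - z)^2 / (y z^2) at most [eps] |y - z|. *)
  exists (Rmin (Cmod z / 2) (eps * Cmod z ^ 3 / 2)); split.
  { apply Rmin_case; [lra|]. apply Rdiv_lt_0_compat; [|lra].
    apply Rmult_lt_0_compat; [lra | apply pow_lt, Hm]. }
  intros y Hy.
  assert (H1 := Rlt_le_trans _ _ _ Hy (Rmin_l _ _)).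
  assert (H2 := Rlt_le_trans _ _ _ Hy (Rmin_r _ _)).
  assert (Hy2 : Cmod z / 2 <= Cmod y).
  { assert (T := Cmod_triangle (z - y) y).
    replace (z - y + y)%C with z in T by ring.
    replace (z - y)%C with (- (y - z))%C in T by ring. rewrite Cmod_opp in T. lra. }
  assert (Hy0 : y <> RtoC 0).
  { apply Cmod_gt_0. lra. }
  replace (/ y - / z - (y - z) * - / (z * z))%C with ((y - z) * ((y - z) * / (y * (z * z))))%C
    by (field; auto).
  rewrite Cmod_mult, Rmult_comm. apply Rmult_le_compat_r; [apply Cmod_ge_0|].
  rewrite Cmod_mult, Cmod_inv by (repeat apply Cmult_neq_0; auto).
  rewrite !Cmod_mult.
  assert (Q : 0 < Cmod y * (Cmod z * Cmod z)) by (repeat apply Rmult_lt_0_compat; lra).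
  apply Rmult_le_reg_r with (1 := Q). rewrite Rmult_assoc, Rinv_l, Rmult_1_r by lra.
  apply Rle_trans with (eps * Cmod z ^ 3 / 2); [lra|].
  replace (eps * Cmod z ^ 3 / 2) with (eps * (Cmod z / 2 * (Cmod z * Cmod z))) by field.
  apply Rmult_le_compat_l; [lra|]. apply Rmult_le_compat_r; [nra|lra].
Qed.

Lemma is_Cderive_inv (f : C -> C) (z l : C) :
  is_Cderive f z l -> f z <> RtoC 0 ->
  is_Cderive (fun x => / f x)%C z (- l / (f z * f z))%C.
Proof.
  intros H N. eapply is_Cderive_eq.
  - apply (is_Cderive_comp Cinv f z _ _ (is_Cderive_Cinv _ N) H).
  - field; auto.
Qed.

(** The outer derivative is over C and the inner one over R. The error splits into that of [F] along
    the increment of [g] and [l] times that of [g], and each part gets half of [eps]. *)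
Lemma is_derive_curve_comp (F : C -> C) (g : R -> C) (t : R) (l dg : C) :
  is_Cderive F (g t) l -> @is_derive R_AbsRing C_R_NormedModule g t dg ->
  @is_derive R_AbsRing C_R_NormedModule (fun s => F (g s)) t (dg * l)%C.
Proof.
  intros HF Hg. rewrite is_Cderive_eps in HF. rewrite is_derive_curve_eps in Hg.
  apply is_derive_curve_eps. intros eps He.
  assert (Pl := Cmod_ge_0 l). assert (Pd := Cmod_ge_0 dg).
  (* A local Lipschitz constant of [g] at [t], valid once the error of [g] is at most |s - t|. This
     is why 1 occurs in the minimum below. *)
  set (k := Cmod dg + 1).
  destruct (HF (eps / (2 * k))) as [d1 [Hd1 H1]].
  { apply Rdiv_lt_0_compat; unfold k; lra. }
  destruct (Hg (Rmin 1 (eps / (2 * (Cmod l + 1))))) as [d2 [Hd2 H2]].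
  { apply Rmin_case; [lra|]. apply Rdiv_lt_0_compat; lra. }
  exists (Rmin d2 (d1 / k)); split.
  { apply Rmin_case; [lra|]. apply Rdiv_lt_0_compat; unfold k; lra. }
  intros s Hs.
  assert (S1 := Rlt_le_trans _ _ _ Hs (Rmin_l _ _)).
  assert (S2 := Rlt_le_trans _ _ _ Hs (Rmin_r _ _)).
  specialize (H2 s S1). set (e := Rabs (s - t)) in *.
  assert (Pe : 0 <= e) by apply Rabs_pos.
  assert (G1 : Cmod (g s - g t) <= k * e).
  { replace (g s - g t)%C with ((g s - g t - RtoC (s - t) * dg) + RtoC (s - t) * dg)%C by ring.
    eapply Rle_trans; [apply Cmod_triangle|].
    rewrite (Cmod_mult (RtoC (s - t)) dg), Cmod_R. fold e.
    assert (M := Rmin_l 1 (eps / (2 * (Cmod l + 1)))). unfold k. nra. }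
  assert (G2 : Cmod (g s - g t) < d1).
  { eapply Rle_lt_trans; [exact G1|].
    apply Rmult_lt_reg_r with (/ k); [apply Rinv_0_lt_compat; unfold k; lra|].
    replace (k * e * / k) with e by (field; unfold k; lra). exact S2. }
  specialize (H1 _ G2).
  replace (F (g s) - F (g t) - RtoC (s - t) * (dg * l))%C with
    ((F (g s) - F (g t) - (g s - g t) * l) + (g s - g t - RtoC (s - t) * dg) * l)%C by ring.
  eapply Rle_trans; [apply Cmod_triangle|]. rewrite (Cmod_mult _ l).
  assert (A1 : Cmod (F (g s) - F (g t) - (g s - g t) * l) <= eps / 2 * e).
  { eapply Rle_trans; [exact H1|].
    replace (eps / 2 * e) with (eps / (2 * k) * (k * e)) by (field; unfold k; lra).
    apply Rmult_le_compat_l; [|exact G1]. left; apply Rdiv_lt_0_compat; unfold k; lra. }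
  assert (A2 : Cmod (g s - g t - RtoC (s - t) * dg) * Cmod l <= eps / 2 * e).
  { eapply Rle_trans; [apply Rmult_le_compat_r; [exact Pl | exact H2]|].
    assert (M := Rmin_r 1 (eps / (2 * (Cmod l + 1)))).
    apply Rle_trans with (eps / (2 * (Cmod l + 1)) * e * Cmod l).
    { apply Rmult_le_compat_r; [exact Pl|]. apply Rmult_le_compat_r; [exact Pe|exact M]. }
    replace (eps / (2 * (Cmod l + 1)) * e * Cmod l) with ((eps / 2 * e) * (Cmod l / (Cmod l + 1))) by (field; lra).
    rewrite <- (Rmult_1_r (eps / 2 * e)) at 2. apply Rmult_le_compat_l; [nra|].
    apply Rle_div_l; lra. }
  lra.
Qed.

Lemma is_derive_curve (g : R -> C) (t x y : R) :
  is_derive (fun s => fst (g s)) t x -> is_derive (fun s => snd (g s)) t y ->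
  @is_derive R_AbsRing C_R_NormedModule g t (x, y).
Proof.
  intros H1 H2.
  apply (is_derive_ext (fun s => (fst (g s), snd (g s)) : C_R_NormedModule)).
  { intros s; destruct (g s); reflexivity. }
  split; [apply is_linear_scal_l|].
  destruct H1 as [_ H1], H2 as [_ H2].
  intros u Hu eps.
  assert (E' : t = u) by (apply (is_filter_lim_locally_unique (K := R_AbsRing) (V := R_NormedModule)), Hu).
  subst u.
  assert (He : 0 < eps / 2) by (destruct eps; simpl; lra).
  specialize (H1 t Hu (mkposreal _ He)). specialize (H2 t Hu (mkposreal _ He)).
  generalize (filter_and _ _ H1 H2). apply filter_imp. intros s [A1 A2].
  rewrite <- Cmod_norm.
  eapply Rle_trans.
  { eapply Rle_trans with (Cmod (RtoC _) + Cmod (Ci * RtoC _)%C); [|apply Rle_refl].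
    eapply Rle_trans; [|apply Cmod_triangle].
    apply Req_le, f_equal.
    instantiate (1 := minus (minus (snd (g s)) (snd (g t))) (scal (minus s t) y)).
    instantiate (1 := minus (minus (fst (g s)) (fst (g t))) (scal (minus s t) x)).
    unfold Cplus, Cmult, Ci, RtoC; simpl. unfold minus, plus, opp; simpl. unfold prod_plus, prod_opp; simpl.
    unfold plus, opp, scal; simpl. unfold mult; simpl. f_equal; ring. }
  rewrite Cmod_mult, Cmod_Ci, !Cmod_R, Rmult_1_l.
  eapply Rle_trans; [apply Rplus_le_compat; [exact A1 | exact A2]|].
  apply Req_le; simpl; field.
Qed.

Lemma is_derive_curve_fst (g : R -> C) (t : R) (l : C) :
  @is_derive R_AbsRing C_R_NormedModule g t l -> is_derive (fun s => fst (g s)) t (fst l).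
Proof.
  intros H.
  apply (filterdiff_comp' g (fun z : C_R_NormedModule => fst z) t _ (fun z : C_R_NormedModule => fst z)) in H.
  - exact H.
  - apply (filterdiff_linear (U := C_R_NormedModule) (V := R_NormedModule)), is_linear_fst.
Qed.

Lemma is_derive_curve_snd (g : R -> C) (t : R) (l : C) :
  @is_derive R_AbsRing C_R_NormedModule g t l -> is_derive (fun s => snd (g s)) t (snd l).
Proof.
  intros H.
  apply (filterdiff_comp' g (fun z : C_R_NormedModule => snd z) t _ (fun z : C_R_NormedModule => snd z)) in H.
  - exact H.
  - apply (filterdiff_linear (U := C_R_NormedModule) (V := R_NormedModule)), is_linear_snd.
Qed.

(** Continuity refers to the product uniform structure, whose balls are squares. They compare with
    discs up to the factor [sqrt 2]. *)
Lemma continuous_C_eps (f : C -> C) (z : C) :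
  continuous f z <->
  (forall eps : R, 0 < eps -> exists delta : R, 0 < delta /\
     forall y : C, Cmod (y - z) < delta -> Cmod (f y - f z) < eps).
Proof.
  split.
  - intros H eps He.
    assert (He2 : 0 < eps / sqrt 2) by (apply Rdiv_lt_0_compat; [lra | apply Rlt_sqrt2_0]).
    assert (H' : locally z (fun y => ball (f z) (eps / sqrt 2) (f y))).
    { apply (proj1 (filterlim_locally _ _) H (mkposreal _ He2)). }
    destruct H' as [d Hd]. exists (pos d); split; [apply cond_pos|].
    intros y Hy.
    specialize (Hd y (C_NormedModule_mixin_compat1 z y d Hy)).
    assert (Q := C_NormedModule_mixin_compat2 (f z) (f y) (mkposreal _ He2) Hd).
    simpl in Q. replace (sqrt 2 * (eps / sqrt 2)) with eps in Q by (field; apply Rgt_not_eq, Rlt_sqrt2_0).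
    exact Q.
  - intros H. apply filterlim_locally. intros eps.
    destruct (H eps (cond_pos eps)) as [d [Hd Hy]].
    assert (Hd2 : 0 < d / sqrt 2) by (apply Rdiv_lt_0_compat; [lra | apply Rlt_sqrt2_0]).
    exists (mkposreal _ Hd2). intros y By.
    apply C_NormedModule_mixin_compat1. apply Hy.
    assert (Q := C_NormedModule_mixin_compat2 z y (mkposreal _ Hd2) By).
    simpl in Q. replace (sqrt 2 * (d / sqrt 2)) with d in Q by (field; apply Rgt_not_eq, Rlt_sqrt2_0).
    exact Q.
Qed.

Lemma is_Cderive_continuous (f : C -> C) (z l : C) :
  is_Cderive f z l -> continuous f z.
Proof.
  rewrite is_Cderive_eps. intros H. apply continuous_C_eps. intros eps He.
  destruct (H 1 Rlt_0_1) as [d [Hd Hy]].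
  assert (Pl := Cmod_ge_0 l).
  exists (Rmin d (eps / (Cmod l + 2))); split.
  { apply Rmin_case; [lra|]. apply Rdiv_lt_0_compat; lra. }
  intros y Y.
  assert (S1 := Rlt_le_trans _ _ _ Y (Rmin_l _ _)).
  assert (S2 := Rlt_le_trans _ _ _ Y (Rmin_r _ _)).
  specialize (Hy y S1).
  replace (f y - f z)%C with ((f y - f z - (y - z) * l) + (y - z) * l)%C by ring.
  eapply Rle_lt_trans; [apply Cmod_triangle|]. rewrite (Cmod_mult _ l).
  assert (0 <= Cmod (y - z)) by apply Cmod_ge_0.
  apply (Rmult_lt_compat_r (Cmod l + 2)) in S2; [|lra].
  unfold Rdiv in S2. rewrite Rmult_assoc, Rinv_l, Rmult_1_r in S2 by lra. nra.
Qed.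

Section ContinuousC.

Context {T : UniformSpace}.

Lemma continuous_C (f : T -> C) (x : T) :
  continuous (fun y => fst (f y)) x -> continuous (fun y => snd (f y)) x -> continuous f x.
Proof.
  intros H1 H2. apply filterlim_locally. intros eps.
  assert (L1 := proj1 (filterlim_locally _ _) H1 eps).
  assert (L2 := proj1 (filterlim_locally _ _) H2 eps).
  generalize (filter_and _ _ L1 L2). apply filter_imp. intros y [A B]. split; assumption.
Qed.

Lemma continuous_Cfst (f : T -> C) (x : T) : continuous f x -> continuous (fun y => fst (f y)) x.
Proof.
  intros H. apply (continuous_comp f fst); [exact H|]. destruct (f x). apply continuous_fst.
Qed.

Lemma continuous_Csnd (f : T -> C) (x : T) : continuous f x -> continuous (fun y => snd (f y)) x.
Proof.
  intros H. apply (continuous_comp f snd); [exact H|]. destruct (f x). apply continuous_snd.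
Qed.

Lemma continuous_Cmult (f g : T -> C) (x : T) :
  continuous f x -> continuous g x -> continuous (fun y => f y * g y)%C x.
Proof.
  intros Hf Hg.
  assert (F1 := continuous_Cfst _ _ Hf). assert (F2 := continuous_Csnd _ _ Hf).
  assert (G1 := continuous_Cfst _ _ Hg). assert (G2 := continuous_Csnd _ _ Hg).
  apply continuous_C; simpl.
  - apply (continuous_minus (V := R_NormedModule)
      (fun y => fst (f y) * fst (g y)) (fun y => snd (f y) * snd (g y)));
    apply (continuous_mult (K := R_AbsRing)); assumption.
  - apply (continuous_plus (V := R_NormedModule)
      (fun y => fst (f y) * snd (g y)) (fun y => snd (f y) * fst (g y)));
    apply (continuous_mult (K := R_AbsRing)); assumption.
Qed.

Lemma continuous_Cplus (f g : T -> C) (x : T) :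
  continuous f x -> continuous g x -> continuous (fun y => f y + g y)%C x.
Proof. apply (continuous_plus (V := C_R_NormedModule)). Qed.

Lemma continuous_Cminus (f g : T -> C) (x : T) :
  continuous f x -> continuous g x -> continuous (fun y => f y - g y)%C x.
Proof. apply (continuous_minus (V := C_R_NormedModule)). Qed.

Lemma continuous_Cinv (f : T -> C) (x : T) :
  continuous f x -> f x <> RtoC 0 -> continuous (fun y => / f y)%C x.
Proof.
  intros H N. apply (continuous_comp f Cinv); [exact H|].
  apply (is_Cderive_continuous _ _ _ (is_Cderive_Cinv _ N)).
Qed.

End ContinuousC.

(** * Integrals of complex-valued functions of a real variable *)

(** The interval with unordered endpoints: primitives are integrated from the origin towards points
    in every quadrant, so both orientations occur. *)
Definition between (a b t : R) : Prop := Rmin a b <= t <= Rmax a b.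

(** Built on the total real integral of each component, so that an integral is a term that can be
    rewritten. For continuous integrands it agrees with the relational integral [is_CInt]. *)
Definition CInt (f : R -> C) (a b : R) : C :=
  (RInt (fun t => fst (f t)) a b, RInt (fun t => snd (f t)) a b).

Notation is_CInt f a b l := (@is_RInt C_R_NormedModule f a b l).

Definition continuous_between (f : R -> C) (a b : R) : Prop :=
  forall t, between a b t -> continuous f t.

Lemma is_CInt_unique (f : R -> C) (a b : R) (l : C) :
  is_CInt f a b l -> CInt f a b = l.
Proof.
  intros H. destruct l as [x y]. unfold CInt. f_equal; apply is_RInt_unique.
  - exact (is_RInt_fct_extend_fst _ _ _ _ H).
  - exact (is_RInt_fct_extend_snd _ _ _ _ H).
Qed.

Lemma CInt_correct (f : R -> C) (a b : R) :
  continuous_between f a b -> is_CInt f a b (CInt f a b).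
Proof.
  intros H. apply (is_RInt_fct_extend_pair (U := R_NormedModule) (V := R_NormedModule));
  apply (RInt_correct (V := R_CompleteNormedModule)), ex_RInt_continuous; intros t Ht.
  - apply continuous_Cfst, H, Ht.
  - apply continuous_Csnd, H, Ht.
Qed.

Lemma between_sym (a b t : R) : between a b t -> between b a t.
Proof. unfold between. rewrite Rmin_comm, Rmax_comm. auto. Qed.

Lemma between_le (a b t : R) : a <= b -> (between a b t <-> a <= t <= b).
Proof. intros H. unfold between. rewrite Rmin_left, Rmax_right by exact H. tauto. Qed.

Lemma between_l (a b : R) : between a b a.
Proof. split; [apply Rmin_l | apply Rmax_l]. Qed.

Lemma between_r (a b : R) : between a b b.
Proof. split; [apply Rmin_r | apply Rmax_r]. Qed.

Lemma between_sub (a b c d t : R) : between a b c -> between a b d -> between c d t -> between a b t.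
Proof.
  unfold between, Rmin, Rmax. repeat destruct Rle_dec; lra.
Qed.

Lemma CInt_ext (f g : R -> C) (a b : R) :
  (forall t, between a b t -> f t = g t) -> CInt f a b = CInt g a b.
Proof.
  intros H. unfold CInt.
  f_equal; apply RInt_ext; intros t Ht; rewrite H; auto; unfold between; lra.
Qed.

Lemma CInt_plus (f g : R -> C) (a b : R) :
  continuous_between f a b -> continuous_between g a b ->
  CInt (fun t => f t + g t)%C a b = (CInt f a b + CInt g a b)%C.
Proof.
  intros Hf Hg. apply is_CInt_unique.
  apply (is_RInt_plus (V := C_R_NormedModule)); apply CInt_correct; assumption.
Qed.

Lemma CInt_minus (f g : R -> C) (a b : R) :
  continuous_between f a b -> continuous_between g a b ->
  CInt (fun t => f t - g t)%C a b = (CInt f a b - CInt g a b)%C.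
Proof.
  intros Hf Hg. apply is_CInt_unique.
  apply (is_RInt_minus (V := C_R_NormedModule)); apply CInt_correct; assumption.
Qed.

(** The integral over a real normed space is only real-linear; a complex factor is expanded into its
    parts. *)
Lemma CInt_scal (c : C) (f : R -> C) (a b : R) :
  continuous_between f a b -> CInt (fun t => c * f t)%C a b = (c * CInt f a b)%C.
Proof.
  intros Hf. assert (H := CInt_correct _ _ _ Hf).
  assert (H1 := is_RInt_fct_extend_fst _ _ _ _ H).
  assert (H2 := is_RInt_fct_extend_snd _ _ _ _ H).
  unfold CInt at 1. unfold Cmult at 3. f_equal; apply is_RInt_unique; simpl.
  - apply (is_RInt_minus (V := R_NormedModule)
      (fun t => fst c * fst (f t)) (fun t => snd c * snd (f t)));
    apply (is_RInt_scal (V := R_NormedModule)); assumption.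
  - apply (is_RInt_plus (V := R_NormedModule)
      (fun t => fst c * snd (f t)) (fun t => snd c * fst (f t)));
    apply (is_RInt_scal (V := R_NormedModule)); assumption.
Qed.

Lemma CInt_const (c : C) (a b : R) : CInt (fun _ => c) a b = (RtoC (b - a) * c)%C.
Proof.
  unfold CInt. rewrite !RInt_const. destruct c as [x y].
  unfold Cmult, RtoC, scal; simpl. unfold mult; simpl. f_equal; ring.
Qed.

Lemma CInt_swap (f : R -> C) (a b : R) :
  continuous_between f a b -> CInt f b a = (- CInt f a b)%C.
Proof.
  intros H. apply is_CInt_unique.
  apply (is_RInt_swap (V := C_R_NormedModule)), CInt_correct, H.
Qed.

Lemma CInt_Chasles (f : R -> C) (a b c : R) :
  continuous_between f a b -> continuous_between f b c ->
  (CInt f a b + CInt f b c)%C = CInt f a c.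
Proof.
  intros H1 H2. symmetry. apply is_CInt_unique.
  apply (is_RInt_Chasles (V := C_R_NormedModule)) with b; apply CInt_correct; assumption.
Qed.

Lemma CInt_point (f : R -> C) (a : R) : CInt f a a = RtoC 0.
Proof. unfold CInt. rewrite !RInt_point. reflexivity. Qed.

Lemma CInt_FTC (f df : R -> C) (a b : R) :
  (forall t, between a b t -> @is_derive R_AbsRing C_R_NormedModule f t (df t)) ->
  continuous_between df a b -> CInt df a b = (f b - f a)%C.
Proof.
  intros H Hc. unfold CInt. unfold Cminus, Cplus, Copp. simpl. f_equal; apply is_RInt_unique.
  - apply (is_RInt_derive (V := R_CompleteNormedModule) (fun t => fst (f t))); intros t Ht.
    + apply is_derive_curve_fst, H, Ht.
    + apply continuous_Cfst, Hc, Ht.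
  - apply (is_RInt_derive (V := R_CompleteNormedModule) (fun t => snd (f t))); intros t Ht.
    + apply is_derive_curve_snd, H, Ht.
    + apply continuous_Csnd, Hc, Ht.
Qed.

Lemma CInt_bound_le (f : R -> C) (a b M : R) :
  a <= b -> continuous_between f a b ->
  (forall t, between a b t -> Cmod (f t) <= M) ->
  Cmod (CInt f a b) <= (b - a) * M.
Proof.
  intros Hab Hc HM. rewrite Cmod_norm.
  apply (norm_RInt_le (V := C_R_NormedModule) f (fun _ => M) a b); auto.
  - intros t Ht. rewrite <- Cmod_norm. apply HM, between_le; auto.
  - apply CInt_correct, Hc.
  - apply (is_RInt_const (V := R_NormedModule) a b M).
Qed.

Lemma CInt_bound (f : R -> C) (a b M : R) :
  continuous_between f a b ->
  (forall t, between a b t -> Cmod (f t) <= M) ->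
  Cmod (CInt f a b) <= Rabs (b - a) * M.
Proof.
  intros Hc HM. destruct (Rle_dec a b) as [H|H].
  - rewrite Rabs_pos_eq by lra. apply CInt_bound_le; auto.
  - rewrite (CInt_swap f b a) by (intros t Ht; apply Hc, between_sym, Ht).
    rewrite Cmod_opp, Rabs_minus_sym, Rabs_pos_eq by lra.
    apply CInt_bound_le; [lra| |]; intros t Ht; [apply Hc | apply HM]; apply between_sym, Ht.
Qed.

(** * Goursat's lemma *)

Definition box (a b c d : R) (z : C) : Prop := between a b (fst z) /\ between c d (snd z).

Definition continuous_box (f : C -> C) (a b c d : R) : Prop :=
  forall z, box a b c d z -> continuous f z.

(** The contour integral along the boundary of a rectangle, counterclockwise when [a <= b] and
    [c <= d]: bottom, right, top, left. The factor [Ci] comes from dz = i dt on the vertical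
    sides. *)
Definition Rect (f : C -> C) (a b c d : R) : C :=
  (CInt (fun t => f (t, c)) a b + Ci * CInt (fun t => f (b, t)) c d
   - CInt (fun t => f (t, d)) a b - Ci * CInt (fun t => f (a, t)) c d)%C.

Lemma continuous_horizontal (f : C -> C) (t c : R) :
  continuous f (t, c) -> continuous (fun s : R => f (s, c)) t.
Proof.
  intros H. apply (continuous_comp (fun s : R => (s, c) : C) f); [|exact H].
  apply continuous_C; simpl; [apply continuous_id | apply continuous_const].
Qed.

Lemma continuous_vertical (f : C -> C) (a t : R) :
  continuous f (a, t) -> continuous (fun s : R => f (a, s)) t.
Proof.
  intros H. apply (continuous_comp (fun s : R => (a, s) : C) f); [|exact H].
  apply continuous_C; simpl; [apply continuous_const | apply continuous_id].
Qed.

Lemma continuous_box_h (f : C -> C) (a b c d y : R) :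
  continuous_box f a b c d -> between c d y -> continuous_between (fun t => f (t, y)) a b.
Proof. intros H Hy t Ht. apply continuous_horizontal, H. split; assumption. Qed.

Lemma continuous_box_v (f : C -> C) (a b c d x : R) :
  continuous_box f a b c d -> between a b x -> continuous_between (fun t => f (x, t)) c d.
Proof. intros H Hx t Ht. apply continuous_vertical, H. split; assumption. Qed.

Lemma box_sub (a b c d a' b' c' d' : R) (z : C) :
  between a b a' -> between a b b' -> between c d c' -> between c d d' ->
  box a' b' c' d' z -> box a b c d z.
Proof.
  intros Ha Hb Hc Hd [Hx Hy]. split.
  - exact (between_sub _ _ _ _ _ Ha Hb Hx).
  - exact (between_sub _ _ _ _ _ Hc Hd Hy).
Qed.

#[local] Hint Resolve between_l between_r : core.

Lemma Rect_split_x (f : C -> C) (a b c d m : R) :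
  continuous_box f a b c d -> between a b m ->
  Rect f a b c d = (Rect f a m c d + Rect f m b c d)%C.
Proof.
  intros Hf Hm. unfold Rect.
  assert (K : forall y, between c d y ->
    CInt (fun t => f (t, y)) a b = (CInt (fun t => f (t, y)) a m + CInt (fun t => f (t, y)) m b)%C).
  { intros y Hy. symmetry. apply CInt_Chasles; intros t Ht;
    refine (continuous_box_h _ _ _ _ _ _ Hf Hy t (between_sub _ _ _ _ _ _ _ Ht)); auto. }
  rewrite !K by auto. ring.
Qed.

Lemma Rect_split_y (f : C -> C) (a b c d m : R) :
  continuous_box f a b c d -> between c d m ->
  Rect f a b c d = (Rect f a b c m + Rect f a b m d)%C.
Proof.
  intros Hf Hm. unfold Rect.
  assert (K : forall x, between a b x ->
    CInt (fun t => f (x, t)) c d = (CInt (fun t => f (x, t)) c m + CInt (fun t => f (x, t)) m d)%C).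
  { intros y Hy. symmetry. apply CInt_Chasles; intros t Ht;
    refine (continuous_box_v _ _ _ _ _ _ Hf Hy t (between_sub _ _ _ _ _ _ _ Ht)); auto. }
  rewrite !K by auto. ring.
Qed.

Lemma Rect_swap_x (f : C -> C) (a b c d : R) :
  continuous_box f a b c d -> Rect f b a c d = (- Rect f a b c d)%C.
Proof.
  intros Hf. unfold Rect.
  rewrite !(CInt_swap _ a b) by (eapply continuous_box_h; eauto). ring.
Qed.

Lemma Rect_swap_y (f : C -> C) (a b c d : R) :
  continuous_box f a b c d -> Rect f a b d c = (- Rect f a b c d)%C.
Proof.
  intros Hf. unfold Rect.
  rewrite !(CInt_swap _ c d) by (eapply continuous_box_v; eauto). ring.
Qed.

Lemma Rect_minus (f g : C -> C) (a b c d : R) :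
  continuous_box f a b c d -> continuous_box g a b c d ->
  Rect (fun z => f z - g z)%C a b c d = (Rect f a b c d - Rect g a b c d)%C.
Proof.
  intros Hf Hg. unfold Rect.
  rewrite (CInt_minus (fun t => f (t, c)) (fun t => g (t, c))),
    (CInt_minus (fun t => f (t, d)) (fun t => g (t, d))) by (eapply continuous_box_h; eauto).
  rewrite (CInt_minus (fun t => f (a, t)) (fun t => g (a, t))),
    (CInt_minus (fun t => f (b, t)) (fun t => g (b, t))) by (eapply continuous_box_v; eauto).
  ring.
Qed.

Lemma is_derive_horizontal (t c : R) :
  @is_derive R_AbsRing C_R_NormedModule (fun s => (s, c)) t (RtoC 1).
Proof.
  apply is_derive_curve; simpl;
  [apply (is_derive_id (K := R_AbsRing)) | apply (is_derive_const (V := R_NormedModule))].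
Qed.

Lemma is_derive_vertical (a t : R) :
  @is_derive R_AbsRing C_R_NormedModule (fun s => (a, s)) t Ci.
Proof.
  apply is_derive_curve; simpl;
  [apply (is_derive_const (V := R_NormedModule)) | apply (is_derive_id (K := R_AbsRing))].
Qed.

Lemma CInt_horizontal_FTC (F f : C -> C) (a b y : R) :
  (forall t, between a b t -> is_Cderive F (t, y) (f (t, y))) ->
  (forall t, between a b t -> continuous f (t, y)) ->
  CInt (fun t => f (t, y)) a b = (F (b, y) - F (a, y))%C.
Proof.
  intros H Hc. apply (CInt_FTC (fun t => F (t, y))).
  - intros t Ht. replace (f (t, y)) with (RtoC 1 * f (t, y))%C by ring.
    apply (is_derive_curve_comp F (fun s => (s, y))); [apply H, Ht | apply is_derive_horizontal].
  - intros t Ht. apply continuous_horizontal, Hc, Ht.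
Qed.

Lemma CInt_vertical_FTC (F f : C -> C) (c d x : R) :
  (forall t, between c d t -> is_Cderive F (x, t) (f (x, t))) ->
  (forall t, between c d t -> continuous f (x, t)) ->
  (Ci * CInt (fun t => f (x, t)) c d)%C = (F (x, d) - F (x, c))%C.
Proof.
  intros H Hc.
  assert (Hc' : continuous_between (fun t => f (x, t)) c d)
    by (intros t Ht; apply continuous_vertical, Hc, Ht).
  rewrite <- CInt_scal by exact Hc'.
  apply (CInt_FTC (fun t => F (x, t))).
  - intros t Ht.
    apply (is_derive_curve_comp F (fun s => (x, s))); [apply H, Ht | apply is_derive_vertical].
  - intros t Ht. apply continuous_Cmult; [apply continuous_const | apply Hc', Ht].
Qed.

(** Each side contributes the difference of the primitive at its two ends, and the corner values
    cancel around the boundary. *)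
Lemma Rect_primitive (F f : C -> C) (a b c d : R) :
  continuous_box f a b c d ->
  (forall z, box a b c d z -> is_Cderive F z (f z)) -> Rect f a b c d = RtoC 0.
Proof.
  intros Hc H. unfold Rect.
  rewrite (CInt_horizontal_FTC F f a b c), (CInt_horizontal_FTC F f a b d),
    (CInt_vertical_FTC F f c d a), (CInt_vertical_FTC F f c d b);
  try (intros t Ht; first [apply H | apply Hc]; split; simpl; auto).
  ring.
Qed.

Lemma Rect_bound (f : C -> C) (a b c d M : R) :
  continuous_box f a b c d -> (forall z, box a b c d z -> Cmod (f z) <= M) ->
  Cmod (Rect f a b c d) <= 2 * (Rabs (b - a) + Rabs (d - c)) * M.
Proof.
  intros Hc HM. unfold Rect.
  assert (Kh : forall y, between c d y -> Cmod (CInt (fun t => f (t, y)) a b) <= Rabs (b - a) * M).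
  { intros y Hy. apply CInt_bound; [eapply continuous_box_h; eauto|].
    intros t Ht; apply HM; split; assumption. }
  assert (Kv : forall x, between a b x -> Cmod (Ci * CInt (fun t => f (x, t)) c d) <= Rabs (d - c) * M).
  { intros x Hx. rewrite Cmod_mult, Cmod_Ci, Rmult_1_l.
    apply CInt_bound; [eapply continuous_box_v; eauto|].
    intros t Ht; apply HM; split; assumption. }
  assert (T : forall p q r s : C, Cmod (p + q - r - s) <= Cmod p + Cmod q + Cmod r + Cmod s).
  { intros p q r s. unfold Cminus.
    assert (T1 := Cmod_triangle (p + q + - r) (- s)).
    assert (T2 := Cmod_triangle (p + q) (- r)).
    assert (T3 := Cmod_triangle p q). rewrite !Cmod_opp in *. lra. }
  eapply Rle_trans; [apply T|].
  assert (A1 := Kh c (between_l _ _)). assert (A2 := Kh d (between_r _ _)).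
  assert (A3 := Kv a (between_l _ _)). assert (A4 := Kv b (between_r _ _)). lra.
Qed.

(** * Bisection of a rectangle *)

Section Bisection.

Variables (f : C -> C) (L M : R).
Hypotheses (HL : 0 <= L) (HM : 0 <= M).

Definition sub_rect (n : nat) (p : R * R) : C :=
  Rect f (fst p) (fst p + L / 2 ^ n) (snd p) (snd p + M / 2 ^ n).

(** Chooses a quarter carrying at least a quarter of the modulus of the integral. The last quarter
    is the untested default; if the other three fail, it must qualify. *)
Definition next_corner (n : nat) (p : R * R) : R * R :=
  let big q := if Rle_dec (Cmod (sub_rect n p) / 4) (Cmod (sub_rect (S n) q)) then true else false in
  let l := L / 2 ^ S n in let m := M / 2 ^ S n in
  let q1 := p in
  let q2 := (fst p + l, snd p) in
  let q3 := (fst p, snd p + m) in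
  let q4 := (fst p + l, snd p + m) in
  if big q1 then q1 else if big q2 then q2 else if big q3 then q3 else q4.

Fixpoint corner (p0 : R * R) (n : nat) : R * R :=
  match n with O => p0 | S n => next_corner n (corner p0 n) end.

Lemma half_width (w : R) (n : nat) : w / 2 ^ n = 2 * (w / 2 ^ S n).
Proof. simpl. field. apply pow_nonzero. lra. Qed.

Lemma width_pos (w : R) (n : nat) : 0 <= w -> 0 <= w / 2 ^ n.
Proof.
  intros H. apply Rmult_le_pos; [exact H|]. left. apply Rinv_0_lt_compat, pow_lt. lra.
Qed.

Lemma next_corner_range (n : nat) (p : R * R) :
  (fst p <= fst (next_corner n p) <= fst p + L / 2 ^ S n) /\
  (snd p <= snd (next_corner n p) <= snd p + M / 2 ^ S n).
Proof.
  assert (A := width_pos L (S n) HL). assert (B := width_pos M (S n) HM).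
  unfold next_corner.
  repeat match goal with |- context [Rle_dec ?u ?v] => destruct (Rle_dec u v) end;
  cbn [fst snd]; lra.
Qed.

Lemma next_corner_big (n : nat) (p : R * R) :
  continuous_box f (fst p) (fst p + L / 2 ^ n) (snd p) (snd p + M / 2 ^ n) ->
  Cmod (sub_rect n p) / 4 <= Cmod (sub_rect (S n) (next_corner n p)).
Proof.
  intros Hc.
  assert (A := width_pos L (S n) HL). assert (B := width_pos M (S n) HM).
  assert (E : sub_rect n p = (sub_rect (S n) p
      + sub_rect (S n) ((fst p + L / 2 ^ S n)%R, snd p)
      + sub_rect (S n) (fst p, (snd p + M / 2 ^ S n)%R)
      + sub_rect (S n) ((fst p + L / 2 ^ S n)%R, (snd p + M / 2 ^ S n)%R))%C).
  { unfold sub_rect. rewrite (half_width L n), (half_width M n) in *. cbn [fst snd].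
    set (l := L / 2 ^ S n) in *. set (m := M / 2 ^ S n) in *.
    destruct p as [x y]; cbn [fst snd] in *.
    rewrite (Rect_split_x f _ _ _ _ (x + l)) by (auto; apply between_le; lra).
    rewrite (Rect_split_y f x _ _ _ (y + m)).
    2:{ intros z Hz. apply Hc. eapply box_sub; [..|exact Hz]; apply between_le; lra. }
    2:{ apply between_le; lra. }
    rewrite (Rect_split_y f (x + l) _ _ _ (y + m)).
    2:{ intros z Hz. apply Hc. eapply box_sub; [..|exact Hz]; apply between_le; lra. }
    2:{ apply between_le; lra. }
    replace (x + l + l) with (x + 2 * l) by ring.
    replace (y + m + m) with (y + 2 * m) by ring.
    ring. }
  unfold next_corner.
  repeat match goal with |- context [Rle_dec ?u ?v] => destruct (Rle_dec u v) end; auto.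
  (* Only the default is left: three quarters contribute less than a fourth of the total each, so
     the triangle inequality leaves at least a fourth for the last. *)
  rewrite E in *.
  set (r1 := sub_rect (S n) p) in *.
  set (r2 := sub_rect (S n) ((fst p + L / 2 ^ S n)%R, snd p)) in *.
  set (r3 := sub_rect (S n) (fst p, (snd p + M / 2 ^ S n)%R)) in *.
  set (r4 := sub_rect (S n) ((fst p + L / 2 ^ S n)%R, (snd p + M / 2 ^ S n)%R)) in *.
  assert (T1 := Cmod_triangle (r1 + r2 + r3) r4).
  assert (T2 := Cmod_triangle (r1 + r2) r3).
  assert (T3 := Cmod_triangle r1 r2). lra.
Qed.

Lemma corner_mono (p0 : R * R) (n k : nat) :
  let p := corner p0 n in let q := corner p0 (n + k) in
  (fst p <= fst q /\ fst q + L / 2 ^ (n + k) <= fst p + L / 2 ^ n) /\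
  (snd p <= snd q /\ snd q + M / 2 ^ (n + k) <= snd p + M / 2 ^ n).
Proof.
  induction k as [|k IH]; cbn zeta in *.
  - rewrite Nat.add_0_r. lra.
  - rewrite Nat.add_succ_r. cbn [corner].
    assert (N := next_corner_range (n + k) (corner p0 (n + k))).
    assert (E1 := half_width L (n + k)). assert (E2 := half_width M (n + k)).
    lra.
Qed.

(** The nested-interval principle in each coordinate, with the supremum of the left ends as the
    common point. *)
Lemma corner_limit (p0 : R * R) :
  exists z : C, forall n, let p := corner p0 n in
    box (fst p) (fst p + L / 2 ^ n) (snd p) (snd p + M / 2 ^ n) z.
Proof.
  assert (K : forall (w : R) (u : nat -> R), 0 <= w ->
    (forall n k, u n <= u (n + k)%nat /\ u (n + k)%nat + w / 2 ^ (n + k) <= u n + w / 2 ^ n) ->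
    exists x, forall n, between (u n) (u n + w / 2 ^ n) x).
  { intros w u Hw Hu.
    (* Every left end lies below every right end: both are compared with the interval of generation
       [n + m]. *)
    assert (U : forall n m, u n <= u m + w / 2 ^ m).
    { intros n m. assert (P1 := Hu n m). assert (P2 := Hu m n).
      rewrite (Nat.add_comm m n) in P2. assert (W := width_pos w (n + m) Hw).
      lra. }
    destruct (completeness (fun y => exists n, y = u n)) as [x [X1 X2]].
    - exists (u O + w / 2 ^ 0). intros y [n ->]. apply U.
    - exists (u O), O. reflexivity.
    - exists x. intros n. apply between_le; [assert (W := width_pos w n Hw); lra|]. split.
      + apply X1. exists n; reflexivity.
      + apply X2. intros y [m ->]. apply U. }
  destruct (K L (fun n => fst (corner p0 n)) HL) as [x Hx].
  { intros n k. apply corner_mono. }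
  destruct (K M (fun n => snd (corner p0 n)) HM) as [y Hy].
  { intros n k. apply corner_mono. }
  exists (x, y). intros n. split; [apply Hx | apply Hy].
Qed.

End Bisection.

(** Serves to discard the first-order part of a function at a point: having a primitive, it
    integrates to 0 around every rectangle. *)
Lemma is_Cderive_affine_primitive (u l p z : C) :
  is_Cderive (fun x => u * x + l * ((x - p) * (x - p) / 2))%C z (u + (z - p) * l)%C.
Proof.
  eapply is_Cderive_eq.
  - apply is_Cderive_plus; [apply is_Cderive_scal, is_Cderive_id|].
    apply is_Cderive_scal. unfold Cdiv. apply is_Cderive_mult; [|apply is_Cderive_const].
    apply is_Cderive_mult; (apply is_Cderive_minus; [apply is_Cderive_id | apply is_Cderive_const]).
  - simpl. field.
Qed.

Lemma Cmod_le_Rabs (z : C) : Cmod z <= Rabs (fst z) + Rabs (snd z).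
Proof.
  destruct z as [x y]. cbn [fst snd].
  replace (x, y) with (RtoC x + Ci * RtoC y)%C
    by (unfold Cplus, Cmult, Ci, RtoC; simpl; f_equal; ring).
  eapply Rle_trans; [apply Cmod_triangle|].
  rewrite Cmod_mult, Cmod_Ci, !Cmod_R. lra.
Qed.

(** If the integral had modulus e0 > 0, the n-th chosen rectangle would carry at least e0 / 4^n.
    Near the common point [f] differs from its affine part by at most a small multiple of the
    distance; diameter and perimeter both scale as 1 / 2^n, so the integral is a smaller multiple of
    1 / 4^n. *)
Lemma Goursat_le (f : C -> C) (a b c d : R) :
  a <= b -> c <= d ->
  (forall z, box a b c d z -> exists l, is_Cderive f z l) ->
  Rect f a b c d = RtoC 0.
Proof.
  intros Hab Hcd Hf.
  set (L := b - a). set (M := d - c).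
  assert (HL : 0 <= L) by (unfold L; lra). assert (HM : 0 <= M) by (unfold M; lra).
  set (p := corner f L M (a, c)).
  assert (Hc : continuous_box f a b c d).
  { intros z Hz. destruct (Hf z Hz) as [l Hl]. apply (is_Cderive_continuous _ _ _ Hl). }
  assert (Hsub : forall n z,
    box (fst (p n)) (fst (p n) + L / 2 ^ n) (snd (p n)) (snd (p n) + M / 2 ^ n) z -> box a b c d z).
  { intros n z Hz. assert (N := corner_mono f L M HL HM (a, c) 0 n).
    cbn [corner Nat.add fst snd pow] in N. fold p in N.
    assert (W1 := width_pos L n HL). assert (W2 := width_pos M n HM).
    unfold Rdiv in N at 2 4. rewrite Rinv_1, !Rmult_1_r in N.
    eapply box_sub; [..|exact Hz]; apply between_le; unfold L, M in *; lra. }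
  assert (Hbig : forall n, Cmod (Rect f a b c d) / 4 ^ n <= Cmod (sub_rect f L M n (p n))).
  { induction n as [|n IH].
    - unfold sub_rect, p. cbn [corner fst snd pow]. unfold Rdiv. rewrite Rinv_1, !Rmult_1_r.
      unfold L, M. replace (a + (b - a)) with b by ring. replace (c + (d - c)) with d by ring. lra.
    - assert (N := next_corner_big f L M HL HM n (p n)).
      cbn [corner] in *. change (p (S n)) with (next_corner f L M n (p n)).
      eapply Rle_trans; [|apply N; intros z Hz; apply Hc, (Hsub n), Hz].
      simpl pow. replace (Cmod (Rect f a b c d) / (4 * 4 ^ n)) with (Cmod (Rect f a b c d) / 4 ^ n / 4)
        by (field; apply pow_nonzero; lra). lra. }
  destruct (corner_limit f L M HL HM (a, c)) as [z Hz]. fold p in Hz. cbn zeta in Hz.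
  destruct (Hf z (Hsub O z (Hz O))) as [l Hl]. rewrite is_Cderive_eps in Hl.
  apply Cmod_eq_0. apply Rle_antisym; [|apply Cmod_ge_0].
  apply Rnot_lt_le. intros Hpos. set (e0 := Cmod (Rect f a b c d)) in *.
  assert (HS : 0 <= (L + M) ^ 2) by (apply pow2_ge_0).
  (* With perimeter 2 s (L + M) and distances at most s (L + M), where s = 1 / 2^n, this accuracy
     bounds the integral by s^2 e0 / 2. The added 1 covers the degenerate rectangle. *)
  destruct (Hl (e0 / (4 * ((L + M) ^ 2 + 1)))) as [delta [Hd Hy]].
  { apply Rdiv_lt_0_compat; lra. }
  destruct (pow_lt_1_zero (/ 2)) with (delta / (L + M + 1)) as [n Hn].
  { rewrite Rabs_pos_eq; lra. }
  { apply Rdiv_lt_0_compat; lra. }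
  specialize (Hn n (le_n n)).
  rewrite Rabs_pos_eq in Hn by (apply pow_le; lra).
  rewrite pow_inv in Hn.
  set (s := / 2 ^ n) in *.
  assert (Hs : 0 < s) by (apply Rinv_0_lt_compat, pow_lt; lra).
  assert (Hs4 : / 4 ^ n = s * s).
  { unfold s. rewrite <- Rinv_mult, <- Rpow_mult_distr. replace (2 * 2) with 4 by ring. reflexivity. }
  assert (Hsmall : s * (L + M) < delta).
  { apply (Rmult_lt_compat_r (L + M + 1)) in Hn; [|lra].
    unfold Rdiv in Hn. rewrite Rmult_assoc, Rinv_l, Rmult_1_r in Hn by lra. nra. }
  specialize (Hbig n). unfold Rdiv at 1 in Hbig. rewrite Hs4 in Hbig.
  specialize (Hsub n). specialize (Hz n). unfold sub_rect in Hbig.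
  unfold Rdiv in Hsub, Hz, Hbig. fold s in Hsub, Hz, Hbig.
  set (x := fst (p n)) in *. set (y := snd (p n)) in *.
  assert (Hc' : continuous_box f x (x + L * s) y (y + M * s)).
  { intros w Hw. apply Hc, Hsub, Hw. }
  assert (Ha : continuous_box (fun w => f z + (w - z) * l)%C x (x + L * s) y (y + M * s)).
  { intros w Hw. apply continuous_Cplus; [apply continuous_const|].
    apply continuous_Cmult; [|apply continuous_const].
    apply continuous_Cminus; [apply continuous_id | apply continuous_const]. }
  (* Subtracting the affine part at [z] leaves the integral unchanged and makes the integrand
     small. *)
  assert (E : Rect f x (x + L * s) y (y + M * s) =
    Rect (fun w => f w - (f z + (w - z) * l))%C x (x + L * s) y (y + M * s)).
  { rewrite Rect_minus by assumption.
    rewrite (Rect_primitive (fun x => f z * x + l * ((x - z) * (x - z) / 2))%C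
      (fun w => f z + (w - z) * l)%C); [ring | assumption |].
    intros w Hw. apply is_Cderive_affine_primitive. }
  rewrite E in Hbig.
  assert (Q := Rect_bound (fun w => f w - (f z + (w - z) * l))%C x (x + L * s) y (y + M * s)
    (e0 / (4 * ((L + M) ^ 2 + 1)) * (s * (L + M)))).
  assert (W : forall w, box x (x + L * s) y (y + M * s) w -> Cmod (w - z) <= s * (L + M)).
  { intros w [w1 w2]. destruct Hz as [z1 z2]. eapply Rle_trans; [apply Cmod_le_Rabs|].
    assert (0 <= L * s) by nra. assert (0 <= M * s) by nra.
    rewrite between_le in w1, w2, z1, z2 by lra.
    destruct w as [wx wy], z as [zx zy]. cbn [fst snd] in *. simpl.
    assert (Rabs (wx + - zx) <= L * s) by (apply Rabs_le; lra).
    assert (Rabs (wy + - zy) <= M * s) by (apply Rabs_le; lra). lra. }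
  eapply Rle_trans in Q; [|exact Hbig|..].
  - replace (x + L * s - x) with (L * s) in Q by ring.
    replace (y + M * s - y) with (M * s) in Q by ring.
    rewrite !Rabs_pos_eq in Q by nra.
    replace (2 * (L * s + M * s) * (e0 / (4 * ((L + M) ^ 2 + 1)) * (s * (L + M))))
      with ((s * s) * (e0 * ((L + M) ^ 2 / (2 * ((L + M) ^ 2 + 1))))) in Q by (field; lra).
    rewrite Rmult_comm in Q. apply Rmult_le_reg_l in Q; [|nra].
    assert ((L + M) ^ 2 / (2 * ((L + M) ^ 2 + 1)) <= / 2).
    { apply Rle_div_l; lra. }
    nra.
  - intros w Hw. apply continuous_Cminus; [apply Hc', Hw | apply Ha, Hw].
  - intros w Hw. replace (f w - (f z + (w - z) * l))%C with (f w - f z - (w - z) * l)%C by ring.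
    eapply Rle_trans; [apply Hy|].
    + eapply Rle_lt_trans; [apply W, Hw | exact Hsmall].
    + apply Rmult_le_compat_l; [|apply W, Hw]. left. apply Rdiv_lt_0_compat; lra.
Qed.

Lemma box_swap_x (a b c d : R) (z : C) : box a b c d z -> box b a c d z.
Proof. intros [H1 H2]. split; [apply between_sym, H1 | exact H2]. Qed.

Lemma box_swap_y (a b c d : R) (z : C) : box a b c d z -> box a b d c z.
Proof. intros [H1 H2]. split; [exact H1 | apply between_sym, H2]. Qed.

(** Reversing a pair of sides only changes the sign, so the order of the corners does not matter. *)
Lemma Goursat (f : C -> C) (a b c d : R) :
  (forall z, box a b c d z -> exists l, is_Cderive f z l) ->
  Rect f a b c d = RtoC 0.
Proof.
  assert (G : forall a b c d, c <= d ->
    (forall z, box a b c d z -> exists l, is_Cderive f z l) -> Rect f a b c d = RtoC 0).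
  { clear. intros a b c d Hcd H. destruct (Rle_dec a b) as [Hab|Hab].
    - apply Goursat_le; auto.
    - rewrite Rect_swap_x.
      + rewrite Goursat_le; [ring | lra | exact Hcd |]. intros z Hz. apply H, box_swap_x, Hz.
      + intros z Hz. destruct (H z (box_swap_x _ _ _ _ _ Hz)) as [l Hl].
        apply (is_Cderive_continuous _ _ _ Hl). }
  intros H. destruct (Rle_dec c d) as [Hcd|Hcd].
  - apply G; auto.
  - rewrite Rect_swap_y.
    + rewrite G; [ring | lra |]. intros z Hz. apply H, box_swap_y, Hz.
    + intros z Hz. destruct (H z (box_swap_y _ _ _ _ _ Hz)) as [l Hl].
      apply (is_Cderive_continuous _ _ _ Hl).
Qed.

(** * Rectangles with an exceptional point *)

Lemma continuous_box_sub (f : C -> C) (a b c d a' b' c' d' : R) :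
  continuous_box f a b c d ->
  between a b a' -> between a b b' -> between c d c' -> between c d d' ->
  continuous_box f a' b' c' d'.
Proof. intros Hf Ha Hb Hc Hd z Hz. exact (Hf z (box_sub _ _ _ _ _ _ _ _ _ Ha Hb Hc Hd Hz)). Qed.

Lemma Rect_degenerate_x (f : C -> C) (a c d : R) : Rect f a a c d = RtoC 0.
Proof. unfold Rect. rewrite !CInt_point. ring. Qed.

Lemma Rect_degenerate_y (f : C -> C) (a b c : R) : Rect f a b c c = RtoC 0.
Proof. unfold Rect. rewrite !CInt_point. ring. Qed.

Lemma between_affine (a b t : R) : 0 <= t <= 1 -> between a b (a + t * (b - a)).
Proof. intros Ht. unfold between, Rmin, Rmax. destruct Rle_dec; nra. Qed.

Lemma between_affine_neq (a b t : R) : 0 < t <= 1 -> a <> b -> ~ between (a + t * (b - a)) b a.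
Proof. intros Ht N. unfold between, Rmin, Rmax. destruct Rle_dec; intros H; apply N; nra. Qed.

(** Cutting off a copy of the rectangle scaled by t at the bad corner leaves pieces to which
    Goursat's lemma applies. Continuity bounds [f] on the small copy, whose perimeter is
    proportional to t, so the integral is O(t). *)
Lemma Rect_punctured_corner (f : C -> C) (a b c d : R) :
  continuous_box f a b c d ->
  (forall z, box a b c d z -> z <> (a, c) -> exists l, is_Cderive f z l) ->
  Rect f a b c d = RtoC 0.
Proof.
  intros Hc Hd.
  destruct (Req_dec a b) as [<-|Nab]; [apply Rect_degenerate_x|].
  destruct (Req_dec c d) as [<-|Ncd]; [apply Rect_degenerate_y|].
  set (w := Rabs (b - a) + Rabs (d - c)).
  assert (Hw : 0 < w).
  { unfold w. assert (0 < Rabs (b - a)) by (apply Rabs_pos_lt; lra).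
    assert (0 <= Rabs (d - c)) by apply Rabs_pos. lra. }
  assert (Hp : box a b c d (a, c)) by (split; simpl; auto).
  (* On the [delta]-disc about the corner |f| is at most |f (a, c)| + 1; here [2 * w] is the
     perimeter, so [t * K] bounds the integral over the scaled copy. *)
  destruct (proj1 (continuous_C_eps _ _) (Hc _ Hp) 1 Rlt_0_1) as [delta [Hdelta Hnear]].
  set (K := 2 * w * (Cmod (f (a, c)) + 1)).
  assert (HK : 0 < K).
  { unfold K. assert (0 <= Cmod (f (a, c))) by apply Cmod_ge_0. nra. }
  assert (Hsmall : forall t, 0 < t <= 1 -> t * w < delta -> Cmod (Rect f a b c d) <= t * K).
  { intros t Ht Htw.
    assert (Bx := between_affine a b t (conj (Rlt_le _ _ (proj1 Ht)) (proj2 Ht))).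
    assert (By := between_affine c d t (conj (Rlt_le _ _ (proj1 Ht)) (proj2 Ht))).
    set (m := a + t * (b - a)) in *. set (n := c + t * (d - c)) in *.
    assert (S : forall z, box a m c n z -> box a b c d z).
    { intros z. apply box_sub; auto. }
    rewrite (Rect_split_x f a b c d m Hc Bx).
    rewrite (Rect_split_y f a m c d n) by (auto; apply (continuous_box_sub _ _ _ _ _ _ _ _ _ Hc); auto).
    rewrite (Goursat f m b c d).
    2:{ intros z Hz. apply Hd.
        - revert Hz. apply box_sub; auto.
        - intros ->. apply (between_affine_neq a b t Ht Nab). apply Hz. }
    rewrite (Goursat f a m n d).
    2:{ intros z Hz. apply Hd.
        - revert Hz. apply box_sub; auto.
        - intros ->. apply (between_affine_neq c d t Ht Ncd). apply Hz. }
    rewrite !Cplus_0_r.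
    eapply Rle_trans.
    - apply Rect_bound with (M := Cmod (f (a, c)) + 1).
      + intros z Hz. apply Hc, S, Hz.
      + intros z [z1 z2].
        replace (f z) with ((f z - f (a, c)) + f (a, c))%C by ring.
        eapply Rle_trans; [apply Cmod_triangle|].
        assert (Cmod (f z - f (a, c)) < 1); [|lra].
        apply Hnear. eapply Rle_lt_trans; [apply Cmod_le_Rabs|].
        eapply Rle_lt_trans; [|exact Htw].
        assert (T : forall p q s x, q = p + t * (s - p) -> between p q x -> Rabs (x + - p) <= t * Rabs (s - p)).
        { intros p q s x -> Hx. rewrite <- (Rabs_pos_eq t) at 1 by lra. rewrite <- Rabs_mult.
          unfold between, Rmin, Rmax in Hx. unfold Rabs.
          repeat destruct Rle_dec; repeat destruct Rcase_abs; lra. }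
        unfold w. rewrite Rmult_plus_distr_l.
        apply Rplus_le_compat; [apply (T a m b (fst z)) | apply (T c n d (snd z))]; auto.
    - replace (m - a) with (t * (b - a)) by (unfold m; ring).
      replace (n - c) with (t * (d - c)) by (unfold n; ring).
      rewrite !Rabs_mult, (Rabs_pos_eq t) by lra. unfold K, w. right; ring. }
  apply Cmod_eq_0, Rle_antisym; [|apply Cmod_ge_0]. apply Rnot_lt_le. intros Hpos.
  set (e := Cmod (Rect f a b c d)) in *.
  (* Small enough that t w <= delta / 2 and t K <= e / 2, which contradicts e <= t K. *)
  set (t := Rmin 1 (Rmin (delta / (2 * w)) (e / (2 * K)))).
  assert (T1 : t <= 1) by apply Rmin_l.
  assert (T2 : t <= delta / (2 * w)) by (eapply Rle_trans; [apply Rmin_r | apply Rmin_l]).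
  assert (T3 : t <= e / (2 * K)) by (eapply Rle_trans; [apply Rmin_r | apply Rmin_r]).
  assert (T0 : 0 < t).
  { unfold t. repeat apply Rmin_case; [lra | | ]; apply Rdiv_lt_0_compat; lra. }
  assert (Q := Hsmall t (conj T0 T1)).
  apply (Rmult_le_compat_r w) in T2; [|lra]. apply (Rmult_le_compat_r K) in T3; [|lra].
  replace (delta / (2 * w) * w) with (delta / 2) in T2 by (field; lra).
  replace (e / (2 * K) * K) with (e / 2) in T3 by (field; lra).
  assert (t * w < delta) by lra. specialize (Q H). lra.
Qed.

(** If [p] lies in the rectangle, the lines through it cut out four rectangles having [p] as a
    corner, up to orientation; otherwise Goursat's lemma applies directly. *)
Lemma Rect_punctured (f : C -> C) (a b c d : R) (p : C) :
  continuous_box f a b c d ->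
  (forall z, box a b c d z -> z <> p -> exists l, is_Cderive f z l) ->
  Rect f a b c d = RtoC 0.
Proof.
  intros Hc Hd. destruct p as [x y].
  destruct (Rle_dec (Rmin a b) x) as [X1|]; [destruct (Rle_dec x (Rmax a b)) as [X2|]|];
  [destruct (Rle_dec (Rmin c d) y) as [Y1|]; [destruct (Rle_dec y (Rmax c d)) as [Y2|]|]|..];
  try (apply Goursat; intros z Hz; apply Hd; [exact Hz | intros ->; destruct Hz as [[] []]; simpl in *; lra]).
  assert (X : between a b x) by (split; assumption).
  assert (Y : between c d y) by (split; assumption).
  assert (Z : forall a' c', between a b a' -> between c d c' -> Rect f x a' y c' = RtoC 0).
  { intros a' c' Ha' Hc'. apply Rect_punctured_corner.
    - apply (continuous_box_sub _ _ _ _ _ _ _ _ _ Hc); auto.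
    - intros z Hz Hn. apply Hd; [|exact Hn]. revert Hz. apply box_sub; auto. }
  rewrite (Rect_split_x f a b c d x Hc X).
  rewrite (Rect_split_y f a x c d y), (Rect_split_y f x b c d y); auto;
    try (apply (continuous_box_sub _ _ _ _ _ _ _ _ _ Hc); auto).
  rewrite (Rect_swap_x f x a), (Rect_swap_x f x a), (Rect_swap_y f x a y c), (Rect_swap_y f x b y c);
    try (apply (continuous_box_sub _ _ _ _ _ _ _ _ _ Hc); auto).
  rewrite !Z by auto. ring.
Qed.

(** * Primitives on the disk *)

Lemma Cmod_le_components (x y x' y' : R) :
  Rabs x <= Rabs x' -> Rabs y <= Rabs y' -> Cmod (x, y) <= Cmod (x', y').
Proof.
  intros Hx Hy. unfold Cmod. simpl. apply sqrt_le_1_alt.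
  apply Rsqr_le_abs_1 in Hx, Hy. unfold Rsqr in *. lra.
Qed.

Lemma between_0_Rabs (x t : R) : between 0 x t -> Rabs t <= Rabs x.
Proof. unfold between, Rmin, Rmax, Rabs. repeat destruct Rle_dec; repeat destruct Rcase_abs; lra. Qed.

Lemma box_origin_disk (x y : R) (z : C) : in_disk (x, y) -> box 0 x 0 y z -> in_disk z.
Proof.
  intros H [H1 H2]. destruct z as [u v]. eapply Rle_lt_trans; [|exact H].
  apply Cmod_le_components; apply between_0_Rabs; assumption.
Qed.

(** The integral from the origin along a horizontal and then a vertical segment equals the one along
    the other two sides, since the rectangle between them stays in the disk. An increment of [F]
    thus becomes an integral over two short segments, on which [f] is close to its value at the
    point. *)
Lemma disk_primitive (f : C -> C) (p : C) :
  (forall z, in_disk z -> continuous f z) ->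
  (forall z, in_disk z -> z <> p -> exists l, is_Cderive f z l) ->
  exists F : C -> C, forall z, in_disk z -> is_Cderive F z (f z).
Proof.
  intros Hc Hd.
  set (F := fun z : C => (CInt (fun t => f (t, 0)) 0 (fst z)
    + Ci * CInt (fun t => f (fst z, t)) 0 (snd z))%C).
  exists F.
  (* The same [F] by the other path, vertical segment first. *)
  assert (F2 : forall x y, in_disk (x, y) ->
    F (x, y) = (Ci * CInt (fun t => f (0, t)) 0 y + CInt (fun t => f (t, y)) 0 x)%C).
  { intros x y Hxy.
    assert (R0 : Rect f 0 x 0 y = RtoC 0).
    { apply Rect_punctured with p.
      - intros z Hz. apply Hc, (box_origin_disk _ _ _ Hxy Hz).
      - intros z Hz. apply Hd, (box_origin_disk _ _ _ Hxy Hz). }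
    unfold Rect in R0. unfold F; cbn [fst snd].
    match type of R0 with (?u + ?v - ?w - ?s)%C = _ => 
      replace (u + v)%C with ((u + v - w - s) + (s + w))%C by ring end.
    rewrite R0. ring. }
  assert (Vcont : forall x y, in_disk (x, y) -> continuous_between (fun t => f (x, t)) 0 y).
  { intros x y Hxy t Ht. apply continuous_vertical, Hc, (box_origin_disk _ _ _ Hxy). split; simpl; auto. }
  assert (Hcont : forall x y, in_disk (x, y) -> continuous_between (fun t => f (t, y)) 0 x).
  { intros x y Hxy t Ht. apply continuous_horizontal, Hc, (box_origin_disk _ _ _ Hxy). split; simpl; auto. }
  intros [x y] Hz. apply is_Cderive_eps. intros eps He.
  destruct (proj1 (continuous_C_eps _ _) (Hc _ Hz) (eps / 2)) as [d1 [Hd1 Hn]]; [lra|].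
  set (r := 1 - Cmod (x, y)). assert (Hr : 0 < r) by (unfold r, in_disk in *; lra).
  exists (Rmin d1 r); split; [apply Rmin_case; assumption|].
  intros [x' y'] Hy'.
  assert (S1 := Rlt_le_trans _ _ _ Hy' (Rmin_l _ _)).
  assert (S2 := Rlt_le_trans _ _ _ Hy' (Rmin_r _ _)). clear Hy'.
  set (h := Cmod ((x', y') - (x, y))) in *.
  assert (B : forall u v, between x x' u -> between y y' v -> Cmod ((u, v) - (x, y)) <= h).
  { intros u v Hu Hv. unfold h, Cminus, Cplus, Copp; simpl.
    apply Cmod_le_components;
    [revert Hu | revert Hv]; unfold between, Rmin, Rmax, Rabs;
    repeat destruct Rle_dec; repeat destruct Rcase_abs; lra. }
  assert (D : forall u v, between x x' u -> between y y' v -> in_disk (u, v)).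
  { intros u v Hu Hv. assert (Q := B u v Hu Hv). unfold in_disk.
    replace (u, v) with (((u, v) - (x, y)) + (x, y))%C by ring.
    eapply Rle_lt_trans; [apply Cmod_triangle|]. unfold r in S2. lra. }
  (* The increment passes through (x', y). Its vertical leg uses the definition of [F] and its
     horizontal leg uses [F2]. *)
  assert (E : (F (x', y') - F (x, y) - ((x', y') - (x, y)) * f (x, y))%C =
    (Ci * CInt (fun t => f (x', t) - f (x, y)) y y' + CInt (fun t => f (t, y) - f (x, y)) x x')%C).
  { assert (D1 := D x' y' (between_r _ _) (between_r _ _)).
    assert (D2 := D x' y (between_r _ _) (between_l _ _)).
    rewrite (CInt_minus (fun t => f (x', t)) (fun _ => f (x, y))).
    2:{ intros t Ht. apply continuous_vertical, Hc, D; auto. }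
    2:{ intros t Ht. apply continuous_const. }
    rewrite (CInt_minus (fun t => f (t, y)) (fun _ => f (x, y))).
    2:{ intros t Ht. apply continuous_horizontal, Hc, D; auto. }
    2:{ intros t Ht. apply continuous_const. }
    rewrite !CInt_const.
    assert (E1 : (F (x', y') - F (x', y))%C = (Ci * CInt (fun t => f (x', t)) y y')%C).
    { unfold F; cbn [fst snd].
      rewrite <- (CInt_Chasles (fun t => f (x', t)) 0 y y'); [ring | apply Vcont, D2 |].
      intros t Ht. apply continuous_vertical, Hc, D; auto. }
    assert (E2 : (F (x', y) - F (x, y))%C = CInt (fun t => f (t, y)) x x').
    { rewrite !F2 by assumption.
      rewrite <- (CInt_Chasles (fun t => f (t, y)) 0 x x'); [ring | apply Hcont, Hz |].
      intros t Ht. apply continuous_horizontal, Hc, D; auto. }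
    replace (F (x', y') - F (x, y))%C
      with ((F (x', y') - F (x', y)) + (F (x', y) - F (x, y)))%C by ring.
    rewrite E1, E2.
    replace ((x', y') - (x, y))%C with (RtoC (x' - x) + Ci * RtoC (y' - y))%C
      by (unfold Cminus, Cplus, Cmult, Copp, Ci, RtoC; simpl; f_equal; ring).
    ring. }
  rewrite E.
  eapply Rle_trans; [apply Cmod_triangle|].
  rewrite Cmod_mult, Cmod_Ci, Rmult_1_l.
  assert (C1 : Cmod (CInt (fun t => (f (x', t) - f (x, y))%C) y y') <= Rabs (y' - y) * (eps / 2)).
  { apply CInt_bound.
    - intros t Ht. apply continuous_Cminus; [|apply continuous_const].
      apply continuous_vertical, Hc, D; auto.
    - intros t Ht. left. apply Hn. eapply Rle_lt_trans; [apply B; auto | exact S1]. }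
  assert (C2 : Cmod (CInt (fun t => (f (t, y) - f (x, y))%C) x x') <= Rabs (x' - x) * (eps / 2)).
  { apply CInt_bound.
    - intros t Ht. apply continuous_Cminus; [|apply continuous_const].
      apply continuous_horizontal, Hc, D; auto.
    - intros t Ht. left. apply Hn. eapply Rle_lt_trans; [apply B; auto | exact S1]. }
  assert (Hx : Rabs (x' - x) <= h).
  { exact (Rle_trans _ _ _ (Rmax_l _ _) (Rmax_Cmod ((x', y') - (x, y))%C)). }
  assert (Hy : Rabs (y' - y) <= h).
  { exact (Rle_trans _ _ _ (Rmax_r _ _) (Rmax_Cmod ((x', y') - (x, y))%C)). }
  nra.
Qed.

(** * Cauchy's formula *)

(** The point r e^(i t), in real terms. The complex exponential is later defined from it. *)
Definition circ (r t : R) : C := (r * cos t, r * sin t).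

Lemma Cmod_circ (r t : R) : 0 <= r -> Cmod (circ r t) = r.
Proof.
  intros Hr. unfold Cmod, circ; cbn [fst snd].
  replace ((r * cos t) ^ 2 + (r * sin t) ^ 2) with (r ^ 2).
  - apply sqrt_pow2, Hr.
  - assert (E := sin2_cos2 t). unfold Rsqr in E. nra.
Qed.

Lemma is_derive_circ (r t : R) :
  @is_derive R_AbsRing C_R_NormedModule (circ r) t (Ci * circ r t)%C.
Proof.
  replace (Ci * circ r t)%C with ((- (r * sin t), r * cos t) : C)
    by (unfold circ, Cmult, Ci; simpl; f_equal; ring).
  apply is_derive_curve; unfold circ; cbn [fst snd]; auto_derive; auto; ring.
Qed.

Lemma continuous_circ (r t : R) : continuous (circ r) t.
Proof.
  apply (ex_derive_continuous (V := C_R_NormedModule)). eexists. apply is_derive_circ.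
Qed.

Lemma circ_2PI (r : R) : circ r (2 * PI) = circ r 0.
Proof. unfold circ. rewrite cos_2PI, sin_2PI, cos_0, sin_0. reflexivity. Qed.

(** On the circle dz = i z dt, so this is the contour integral of [f] up to the factor i, and a
    primitive takes the same value at both ends of the closed curve. *)
Lemma circle_integral_primitive (F f : C -> C) (r : R) :
  (forall t, is_Cderive F (circ r t) (f (circ r t))) ->
  (forall t, continuous f (circ r t)) ->
  CInt (fun t => circ r t * f (circ r t))%C 0 (2 * PI) = RtoC 0.
Proof.
  intros HF Hf.
  assert (Hc : continuous_between (fun t => circ r t * f (circ r t))%C 0 (2 * PI)).
  { intros t _. apply continuous_Cmult; [apply continuous_circ|].
    apply (continuous_comp (circ r) f); [apply continuous_circ | apply Hf]. }
  assert (E : (Ci * CInt (fun t => circ r t * f (circ r t)) 0 (2 * PI))%C = RtoC 0).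
  { rewrite <- CInt_scal by exact Hc.
    rewrite (CInt_FTC (fun t => F (circ r t))).
    - rewrite circ_2PI. ring.
    - intros t _. rewrite Cmult_assoc. apply is_derive_curve_comp; [apply HF | apply is_derive_circ].
    - intros t Ht. apply continuous_Cmult; [apply continuous_const | apply Hc, Ht]. }
  replace (CInt (fun t => circ r t * f (circ r t)) 0 (2 * PI))%C
    with (- Ci * (Ci * CInt (fun t => circ r t * f (circ r t)) 0 (2 * PI)))%C.
  - rewrite E. ring.
  - rewrite Cmult_assoc. replace (- Ci * Ci)%C with (RtoC 1); [ring|].
    unfold Cmult, Copp, Ci, RtoC; simpl. f_equal; ring.
Qed.

(** Differentiation under the integral sign. A remainder that is quadratic uniformly in t integrates
    to one that is still quadratic. *)
Lemma is_Cderive_CInt_param (G : C -> R -> C) (G' : R -> C) (z : C) (a b r K : R) :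
  0 < r ->
  (forall y, Cmod (y - z) < r -> continuous_between (G y) a b) ->
  continuous_between G' a b ->
  (forall y t, Cmod (y - z) < r -> between a b t ->
     Cmod (G y t - G z t - (y - z) * G' t) <= K * Cmod (y - z) ^ 2) ->
  is_Cderive (fun y => CInt (G y) a b) z (CInt G' a b).
Proof.
  intros Hr HG HG' HK. apply is_Cderive_eps. intros eps He.
  set (w := Rabs (b - a) * Rabs K). 
  assert (Hw : 0 <= w) by (apply Rmult_le_pos; apply Rabs_pos).
  exists (Rmin r (eps / (w + 1))); split.
  { apply Rmin_case; [exact Hr|]. apply Rdiv_lt_0_compat; lra. }
  intros y Hy.
  assert (S1 := Rlt_le_trans _ _ _ Hy (Rmin_l _ _)).
  assert (S2 := Rlt_le_trans _ _ _ Hy (Rmin_r _ _)). clear Hy.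
  assert (Hz : Cmod (z - z) < r).
  { replace (z - z)%C with (RtoC 0) by ring. rewrite Cmod_0. exact Hr. }
  rewrite <- CInt_scal by exact HG'.
  rewrite <- CInt_minus by auto.
  rewrite <- CInt_minus.
  2:{ intros t Ht. apply continuous_Cminus; apply HG; assumption. }
  2:{ intros t Ht. apply continuous_Cmult; [apply continuous_const | apply HG', Ht]. }
  set (h := Cmod (y - z)) in *. assert (Hh : 0 <= h) by apply Cmod_ge_0.
  eapply Rle_trans.
  - apply CInt_bound with (M := Rabs K * h ^ 2).
    + intros t Ht. apply continuous_Cminus.
      * apply continuous_Cminus; apply HG; assumption.
      * apply continuous_Cmult; [apply continuous_const | apply HG', Ht].
    + intros t Ht. eapply Rle_trans; [apply HK; assumption|].
      apply Rmult_le_compat_r; [apply pow2_ge_0 | apply Rle_abs].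
  - apply (Rmult_lt_compat_r (w + 1)) in S2; [|lra].
    unfold Rdiv in S2. rewrite Rmult_assoc, Rinv_l, Rmult_1_r in S2 by lra.
    replace (Rabs (b - a) * (Rabs K * h ^ 2)) with (w * h * h) by (unfold w; ring).
    apply Rmult_le_compat_r; [exact Hh|]. nra.
Qed.

(** The measure is dt. For [g] equal to [circ r t * f (circ r t)] this is 1 / i times the contour
    integral of f(u) / (u - z)^k du, so Cauchy's formula acquires the factor 2 pi. *)
Definition cauchy_kernel (g : R -> C) (r : R) (k : nat) (z : C) : C :=
  CInt (fun t => g t * / (circ r t - z) ^ k)%C 0 (2 * PI).

Lemma circ_minus_lower (r t : R) (z : C) : 0 <= r -> r - Cmod z <= Cmod (circ r t - z).
Proof.
  intros Hr. assert (T := Cmod_triangle (circ r t - z) z).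
  replace (circ r t - z + z)%C with (circ r t) in T by ring.
  rewrite Cmod_circ in T by exact Hr. lra.
Qed.

Lemma circ_minus_neq_0 (r t : R) (z : C) : Cmod z < r -> (circ r t - z)%C <> RtoC 0.
Proof.
  intros Hz. apply Cmod_gt_0. assert (0 <= Cmod z) by apply Cmod_ge_0.
  assert (T := circ_minus_lower r t z). lra.
Qed.

Lemma Cpow_neq_0 (z : C) (n : nat) : z <> RtoC 0 -> (z ^ n)%C <> RtoC 0.
Proof.
  intros Hz. apply Cmod_gt_0. rewrite Cmod_pow. apply pow_lt, Cmod_gt_0, Hz.
Qed.

Lemma continuous_Cpow {T : UniformSpace} (f : T -> C) (n : nat) (x : T) :
  continuous f x -> continuous (fun y => f y ^ n)%C x.
Proof.
  intros H. induction n as [|n IH]; simpl; [apply continuous_const | apply continuous_Cmult; assumption].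
Qed.

Lemma continuous_cauchy_kernel (g : R -> C) (r : R) (k : nat) (z : C) :
  Cmod z < r -> continuous_between g 0 (2 * PI) ->
  continuous_between (fun t => g t * / (circ r t - z) ^ k)%C 0 (2 * PI).
Proof.
  intros Hz Hg t Ht. apply continuous_Cmult; [apply Hg, Ht|].
  apply continuous_Cinv.
  - apply continuous_Cpow, continuous_Cminus; [apply continuous_circ | apply continuous_const].
  - apply Cpow_neq_0, circ_minus_neq_0, Hz.
Qed.

Lemma continuous_between_bounded (g : R -> C) (a b : R) :
  a <= b -> continuous_between g a b ->
  exists M, 0 <= M /\ forall t, between a b t -> Cmod (g t) <= M.
Proof.
  intros Hab Hg.
  destruct (bounded_continuity (K := R_AbsRing) (V := C_R_NormedModule) g a b) as [M HM].
  - intros t Ht. apply Hg, between_le; auto.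
  - exists (Rmax 0 M). split; [apply Rmax_l|]. intros t Ht. apply (between_le a b t Hab) in Ht.
    rewrite Cmod_norm. eapply Rle_trans; [left; apply HM, Ht | apply Rmax_r].
Qed.

Lemma two_PI_ge_0 : 0 <= 2 * PI.
Proof. assert (H := PI_RGT_0). lra. Qed.

Lemma Cmod_inv_le (u : C) (m : R) : 0 < m -> m <= Cmod u -> Cmod (/ u) <= / m.
Proof.
  intros Hm Hu. rewrite Cmod_inv by (apply Cmod_gt_0; lra). apply Rinv_le_contravar; assumption.
Qed.

Section CauchyKernelDerivative.

Variables (g : R -> C) (r : R) (z : C).
Hypotheses (Hg : continuous_between g 0 (2 * PI)) (Hz : Cmod z < r).

(** Reduces the derivative of a Cauchy integral to a pointwise estimate with u = circ r t - z and h
    = y - z. For |h| below half the distance from |z| to r, both u and u - h stay at least that far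
    from 0. *)
Lemma cauchy_kernel_param (k l : nat) (c : C) (N : R) :
  (forall u h : C, (r - Cmod z) / 2 <= Cmod u -> (r - Cmod z) / 2 <= Cmod (u - h) ->
    Cmod (/ (u - h) ^ k - / u ^ k - h * (c * / u ^ l)) <= N * Cmod h ^ 2) ->
  is_Cderive (cauchy_kernel g r k) z (c * cauchy_kernel g r l z)%C.
Proof.
  intros H. assert (Hz0 := Cmod_ge_0 z).
  assert (Hcl := continuous_cauchy_kernel g r l z Hz Hg).
  destruct (continuous_between_bounded g _ _ two_PI_ge_0 Hg) as [M [HM0 HM]].
  unfold cauchy_kernel at 2. rewrite <- CInt_scal by exact Hcl.
  assert (Hy : forall y, Cmod (y - z) < (r - Cmod z) / 2 -> Cmod y <= (r + Cmod z) / 2).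
  { intros y Hy. replace y with ((y - z) + z)%C by ring.
    eapply Rle_trans; [apply Cmod_triangle|]. lra. }
  apply (is_Cderive_CInt_param (fun z t => g t * / (circ r t - z) ^ k)%C _ z _ _ ((r - Cmod z) / 2) (M * N)).
  - lra.
  - intros y Hyz. specialize (Hy y Hyz). apply continuous_cauchy_kernel; [lra | exact Hg].
  - intros t Ht. apply continuous_Cmult; [apply continuous_const | apply Hcl, Ht].
  - intros y t Hyz Ht. specialize (Hy y Hyz).
    replace (g t * / (circ r t - y) ^ k - g t * / (circ r t - z) ^ k -
      (y - z) * (c * (g t * / (circ r t - z) ^ l)))%C
    with (g t * (/ ((circ r t - z) - (y - z)) ^ k - / (circ r t - z) ^ k -
      (y - z) * (c * / (circ r t - z) ^ l)))%C.
    2:{ replace (circ r t - z - (y - z))%C with (circ r t - y)%C by ring. ring. }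
    rewrite Cmod_mult, Rmult_assoc. apply Rmult_le_compat; try apply Cmod_ge_0.
    + apply HM, Ht.
    + assert (T1 := circ_minus_lower r t z). assert (T2 := circ_minus_lower r t y).
      apply H; [lra|]. replace (circ r t - z - (y - z))%C with (circ r t - y)%C by ring. lra.
Qed.

Lemma is_Cderive_cauchy_kernel_1 :
  is_Cderive (cauchy_kernel g r 1) z (cauchy_kernel g r 2 z).
Proof.
  replace (cauchy_kernel g r 2 z) with (RtoC 1 * cauchy_kernel g r 2 z)%C by ring.
  set (m := (r - Cmod z) / 2). assert (Hm : 0 < m) by (unfold m; lra).
  apply cauchy_kernel_param with (/ m * / m * / m). fold m. intros u h Hu Huh.
  assert (N1 : u <> RtoC 0) by (apply Cmod_gt_0; lra).
  assert (N2 : (u - h)%C <> RtoC 0) by (apply Cmod_gt_0; lra).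
  (* The exact remainder, with h^2 factored out. *)
  replace (/ (u - h) ^ 1 - / u ^ 1 - h * (RtoC 1 * / u ^ 2))%C
    with (/ u * / u * / (u - h) * (h * h))%C by (simpl; field; auto).
  rewrite !Cmod_mult. replace (Cmod h ^ 2) with (Cmod h * Cmod h) by ring.
  assert (I1 := Cmod_inv_le _ _ Hm Hu). assert (I2 := Cmod_inv_le _ _ Hm Huh).
  assert (P1 := Cmod_ge_0 (/ u)). assert (P2 := Cmod_ge_0 (/ (u - h))). assert (P3 := Cmod_ge_0 h).
  apply Rmult_le_compat_r; [nra|]. repeat apply Rmult_le_compat; try assumption. nra.
Qed.

Lemma is_Cderive_cauchy_kernel_2 :
  is_Cderive (cauchy_kernel g r 2) z (RtoC 2 * cauchy_kernel g r 3 z)%C.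
Proof.
  set (m := (r - Cmod z) / 2). assert (Hm : 0 < m) by (unfold m; lra).
  (* The remainder is h^2 times 1 / (u^2 (u - h)^2) + 2 / (u^3 (u - h)): three fourth-order terms,
     each at most 1 / m^4. *)
  apply cauchy_kernel_param with (3 * (/ m * / m * / m * / m)). fold m. intros u h Hu Huh.
  assert (N1 : u <> RtoC 0) by (apply Cmod_gt_0; lra).
  assert (N2 : (u - h)%C <> RtoC 0) by (apply Cmod_gt_0; lra).
  replace (/ (u - h) ^ 2 - / u ^ 2 - h * (RtoC 2 * / u ^ 3))%C
    with ((/ u * / u * / (u - h) * / (u - h) + RtoC 2 * (/ u * / u * / u * / (u - h))) * (h * h))%C
    by (simpl; field; auto).
  rewrite Cmod_mult. replace (Cmod (h * h)) with (Cmod h ^ 2) by (rewrite Cmod_mult; ring).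
  assert (I1 := Cmod_inv_le _ _ Hm Hu). assert (I2 := Cmod_inv_le _ _ Hm Huh).
  assert (P1 := Cmod_ge_0 (/ u)). assert (P2 := Cmod_ge_0 (/ (u - h))).
  apply Rmult_le_compat_r; [apply pow2_ge_0|].
  eapply Rle_trans; [apply Cmod_triangle|].
  rewrite (Cmod_mult (RtoC 2)), Cmod_R, (Rabs_pos_eq 2), !Cmod_mult by lra.
  assert (I3 : Cmod (/ u) * Cmod (/ u) * Cmod (/ (u - h)) * Cmod (/ (u - h)) <= / m * / m * / m * / m).
  { repeat apply Rmult_le_compat; try assumption; repeat apply Rmult_le_pos; assumption. }
  assert (I4 : Cmod (/ u) * Cmod (/ u) * Cmod (/ u) * Cmod (/ (u - h)) <= / m * / m * / m * / m).
  { repeat apply Rmult_le_compat; try assumption; repeat apply Rmult_le_pos; assumption. }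
  lra.
Qed.

End CauchyKernelDerivative.

Lemma continuous_circ_between (r : R) (a b : R) : continuous_between (circ r) a b.
Proof. intros t _. apply continuous_circ. Qed.

Lemma derive_0_constant (F : C -> C) (r : R) (a : C) :
  (forall z, Cmod z < r -> is_Cderive F z (RtoC 0)) -> Cmod a < r -> F a = F (RtoC 0).
Proof.
  intros H Ha.
  assert (E : CInt (fun _ => RtoC 0) 0 1 = (F (RtoC 1 * a) - F (RtoC 0 * a))%C).
  { apply (CInt_FTC (fun t => F (RtoC t * a)%C)).
    - intros t Ht. apply (between_le 0 1 t Rle_0_1) in Ht.
      replace (RtoC 0) with (a * RtoC 0)%C by ring.
      apply (is_derive_curve_comp F (fun s => RtoC s * a)%C).
      + apply H. rewrite Cmod_mult, Cmod_R, Rabs_pos_eq by lra.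
        assert (P := Cmod_ge_0 a). nra.
      + destruct a as [x y]. apply is_derive_curve; unfold Cmult, RtoC; cbn [fst snd]; auto_derive; auto; ring.
    - intros t _. apply continuous_const. }
  rewrite CInt_const, !Cmult_0_r, Cmult_1_l, Cmult_0_l in E.
  replace (F a) with ((F a - F (RtoC 0)) + F (RtoC 0))%C by ring. rewrite <- E. ring.
Qed.

(** As a function of [a] its derivative is the integral of du / (u - a)^2 up to a constant factor,
    which vanishes because - 1 / (u - a) is a primitive. It is therefore constant, with the value at
    a = 0. *)
Lemma cauchy_kernel_circ (r : R) (a : C) :
  Cmod a < r -> cauchy_kernel (circ r) r 1 a = RtoC (2 * PI).
Proof.
  intros Ha. rewrite (derive_0_constant (cauchy_kernel (circ r) r 1) r a); [| |exact Ha].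
  - assert (Hr : 0 < r) by (assert (P := Cmod_ge_0 a); lra).
    unfold cauchy_kernel. rewrite (CInt_ext _ (fun _ => RtoC 1)).
    + rewrite CInt_const. rewrite Rminus_0_r. ring.
    + intros t _. assert (N := circ_minus_neq_0 r t (RtoC 0)). rewrite Cmod_0 in N. specialize (N Hr).
      replace (circ r t - RtoC 0)%C with (circ r t) in * by ring.
      simpl. rewrite Cmult_1_r. apply Cinv_r, N.
  - intros z Hz. apply (is_Cderive_eq _ _ _ _
      (is_Cderive_cauchy_kernel_1 _ _ _ (continuous_circ_between _ _ _) Hz)).
    apply (circle_integral_primitive (fun x => RtoC 0 - / (x - z))%C (fun x => / (x - z) ^ 2)%C).
    + intros t. assert (N := circ_minus_neq_0 r t z Hz). eapply is_Cderive_eq.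
      * apply (is_Cderive_minus (fun _ => RtoC 0) (fun x => / (x - z))%C);
        [apply is_Cderive_const|].
        apply (is_Cderive_inv (fun x => x - z)%C); [|exact N].
        apply is_Cderive_minus; [apply is_Cderive_id | apply is_Cderive_const].
      * simpl; field; exact N.
    + intros t. assert (N := circ_minus_neq_0 r t z Hz).
      apply continuous_Cinv; [|apply Cpow_neq_0, N].
      apply continuous_Cpow, continuous_Cminus; [apply continuous_id | apply continuous_const].
Qed.

(** * Difference quotients and the integral formula *)

Lemma is_Cderive_C_derive (f : C -> C) (z : C) :
  @ex_derive C_AbsRing C_NormedModule f z -> is_Cderive f z (C_derive f z).
Proof. apply C_derive_correct; exact z. Qed.

Lemma C_derive_eq (f : C -> C) (z l : C) : is_Cderive f z l -> C_derive f z = l.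
Proof. apply is_C_derive_unique. Qed.

Definition diff_quot (f : C -> C) (a z : C) : C :=
  if Ceq_dec z a then C_derive f a else ((f z - f a) / (z - a))%C.

Lemma diff_quot_mult (f : C -> C) (a z : C) : ((z - a) * diff_quot f a z)%C = (f z - f a)%C.
Proof.
  unfold diff_quot. destruct Ceq_dec as [->|N]; [ring|]. field.
  intros E. apply N. replace z with ((z - a) + a)%C by ring. rewrite E. ring.
Qed.

Lemma Cminus_neq_0 (z a : C) : z <> a -> (z - a)%C <> RtoC 0.
Proof. intros N E. apply N. replace z with ((z - a) + a)%C by ring. rewrite E. ring. Qed.

Lemma ex_Cderive_diff_quot (f : C -> C) (a z : C) :
  z <> a -> @ex_derive C_AbsRing C_NormedModule f z -> exists l, is_Cderive (diff_quot f a) z l.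
Proof.
  intros N Hf. eexists.
  apply (is_Cderive_ext_near (fun x => (f x - f a) * / (x - a))%C _ _ _ (Cmod (z - a))).
  - apply Cmod_gt_0, Cminus_neq_0, N.
  - intros y Hy. unfold diff_quot. destruct Ceq_dec as [->|_]; [|reflexivity].
    exfalso. replace (a - z)%C with (- (z - a))%C in Hy by ring. rewrite Cmod_opp in Hy. lra.
  - apply is_Cderive_mult.
    + apply is_Cderive_minus; [apply is_Cderive_C_derive, Hf | apply is_Cderive_const].
    + apply (is_Cderive_inv (fun x => x - a)%C); [|apply Cminus_neq_0, N].
      apply is_Cderive_minus; [apply is_Cderive_id | apply is_Cderive_const].
Qed.

Lemma continuous_diff_quot (f : C -> C) (a : C) :
  @ex_derive C_AbsRing C_NormedModule f a -> continuous (diff_quot f a) a.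
Proof.
  intros Hf%is_Cderive_C_derive. rewrite is_Cderive_eps in Hf.
  apply continuous_C_eps. intros eps He.
  destruct (Hf (eps / 2)) as [d [Hd H]]; [lra|]. exists d; split; [exact Hd|].
  intros y Hy. specialize (H y Hy). unfold diff_quot.
  destruct (Ceq_dec a a) as [_|]; [|congruence].
  destruct (Ceq_dec y a) as [E|N].
  - replace (C_derive f a - C_derive f a)%C with (RtoC 0) by ring. rewrite Cmod_0. exact He.
  - apply Cminus_neq_0 in N.
    replace ((f y - f a) / (y - a) - C_derive f a)%C
      with ((f y - f a - (y - a) * C_derive f a) / (y - a))%C by (field; exact N).
    rewrite Cmod_div by exact N. apply Cmod_gt_0 in N.
    apply Rle_lt_trans with (eps / 2); [|lra]. apply Rle_div_l; assumption.
Qed.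

Lemma analytic_continuous (f : C -> C) (z : C) : analytic_on_disk f -> in_disk z -> continuous f z.
Proof. intros Hf Hz. destruct (Hf z Hz) as [l Hl]. apply (is_Cderive_continuous _ _ _ Hl). Qed.

Lemma circ_in_disk (r t : R) : 0 <= r < 1 -> in_disk (circ r t).
Proof. intros H. unfold in_disk. rewrite Cmod_circ; lra. Qed.

Lemma continuous_on_circle (f : C -> C) (r a b : R) :
  analytic_on_disk f -> 0 <= r < 1 -> continuous_between (fun t => f (circ r t)) a b.
Proof.
  intros Hf Hr t _. apply (continuous_comp (circ r) f); [apply continuous_circ|].
  apply analytic_continuous; [exact Hf | apply circ_in_disk, Hr].
Qed.

(* The difference quotient at [a] is continuous on the disk and differentiable off
   [a], so it has a primitive and its integral along the circle vanishes. *)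
Lemma Cauchy_formula (f : C -> C) (r : R) (a : C) :
  analytic_on_disk f -> r < 1 -> Cmod a < r ->
  cauchy_kernel (fun t => circ r t * f (circ r t))%C r 1 a = (RtoC (2 * PI) * f a)%C.
Proof.
  intros Hf Hr Ha. assert (Ha0 := Cmod_ge_0 a).
  assert (Hc : forall z, in_disk z -> continuous (diff_quot f a) z).
  { intros z Hz. destruct (Ceq_dec z a) as [->|N].
    - apply continuous_diff_quot, Hf, Hz.
    - destruct (ex_Cderive_diff_quot f a z N (Hf z Hz)) as [l Hl].
      apply (is_Cderive_continuous _ _ _ Hl). }
  destruct (disk_primitive (diff_quot f a) a Hc) as [F HF].
  { intros z Hz N. apply ex_Cderive_diff_quot; [exact N | apply Hf, Hz]. }
  assert (D : forall t, in_disk (circ r t)) by (intros t; apply circ_in_disk; lra).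
  assert (E := circle_integral_primitive F (diff_quot f a) r (fun t => HF _ (D t)) (fun t => Hc _ (D t))).
  assert (K1 : continuous_between (fun t => circ r t * f (circ r t))%C 0 (2 * PI)).
  { intros t Ht. apply continuous_Cmult; [apply continuous_circ|].
    apply (continuous_on_circle f r 0 (2 * PI) Hf); [lra | exact Ht]. }
  (* The quotient splits into the Cauchy integrand of [f] and [f a] times that of the constant 1,
     whose integral is known. *)
  rewrite (CInt_ext _ (fun t => (circ r t * f (circ r t)) * / (circ r t - a) ^ 1
    - f a * (circ r t * / (circ r t - a) ^ 1))%C) in E.
  2:{ intros t _. unfold diff_quot. assert (N := circ_minus_neq_0 r t a Ha).
      destruct Ceq_dec as [E'|_]; [exfalso; apply N; rewrite E'; ring|].
      simpl. field. exact N. }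
  rewrite CInt_minus in E.
  2:{ apply continuous_cauchy_kernel; assumption. }
  2:{ intros t Ht. apply continuous_Cmult; [apply continuous_const|].
      apply (continuous_cauchy_kernel (circ r)); [assumption | apply continuous_circ_between | exact Ht]. }
  rewrite CInt_scal in E by (apply (continuous_cauchy_kernel (circ r)); [assumption | apply continuous_circ_between]).
  fold (cauchy_kernel (circ r) r 1 a) in E. rewrite cauchy_kernel_circ in E by exact Ha.
  unfold cauchy_kernel.
  replace (RtoC (2 * PI) * f a)%C with (f a * RtoC (2 * PI) + RtoC 0)%C by ring.
  rewrite <- E. ring.
Qed.

(** * Derivatives as circle integrals *)

Lemma two_PI_neq_0 : RtoC (2 * PI) <> RtoC 0.
Proof. intros E. apply RtoC_inj in E. assert (H := PI_RGT_0). lra. Qed.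

Lemma continuous_circ_times (f : C -> C) (r : R) :
  analytic_on_disk f -> 0 <= r < 1 ->
  continuous_between (fun t => circ r t * f (circ r t))%C 0 (2 * PI).
Proof.
  intros Hf Hr t Ht. apply continuous_Cmult; [apply continuous_circ|].
  apply (continuous_on_circle f r 0 (2 * PI) Hf Hr), Ht.
Qed.

Lemma near_radius (r : R) (z y : C) : Cmod (y - z) < r - Cmod z -> Cmod y < r.
Proof.
  intros H. replace y with ((y - z) + z)%C by ring.
  eapply Rle_lt_trans; [apply Cmod_triangle|]. lra.
Qed.

Lemma is_Cderive_Cauchy (f : C -> C) (r : R) (z : C) :
  analytic_on_disk f -> r < 1 -> Cmod z < r ->
  is_Cderive f z (/ RtoC (2 * PI) * cauchy_kernel (fun t => circ r t * f (circ r t)) r 2 z)%C.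
Proof.
  intros Hf Hr Hz. assert (Hz0 := Cmod_ge_0 z).
  apply (is_Cderive_ext_near (fun y => / RtoC (2 * PI) *
    cauchy_kernel (fun t => circ r t * f (circ r t)) r 1 y)%C _ _ _ (r - Cmod z)).
  - lra.
  - intros y Hy. rewrite Cauchy_formula; [|exact Hf | exact Hr | apply (near_radius r z), Hy].
    field. exact two_PI_neq_0.
  - apply is_Cderive_scal, is_Cderive_cauchy_kernel_1; [apply continuous_circ_times; [exact Hf|lra] | exact Hz].
Qed.

Lemma is_Cderive2_Cauchy (f : C -> C) (r : R) (z : C) :
  analytic_on_disk f -> r < 1 -> Cmod z < r ->
  is_Cderive (C_derive f) z
    (/ RtoC (2 * PI) * (RtoC 2 * cauchy_kernel (fun t => circ r t * f (circ r t)) r 3 z))%C.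
Proof.
  intros Hf Hr Hz. assert (Hz0 := Cmod_ge_0 z).
  apply (is_Cderive_ext_near (fun y => / RtoC (2 * PI) *
    cauchy_kernel (fun t => circ r t * f (circ r t)) r 2 y)%C _ _ _ (r - Cmod z)).
  - lra.
  - intros y Hy. symmetry. apply C_derive_eq, is_Cderive_Cauchy; auto. apply (near_radius r z), Hy.
  - apply is_Cderive_scal, is_Cderive_cauchy_kernel_2; [apply continuous_circ_times; [exact Hf|lra] | exact Hz].
Qed.

(** Cauchy's formula can be differentiated twice, on a circle of radius midway between |z| and 1.
    Iterating this closure property gives derivatives of every order. *)
Lemma analytic_C_derive (f : C -> C) : analytic_on_disk f -> analytic_on_disk (C_derive f).
Proof.
  intros Hf z Hz. unfold in_disk in Hz. eexists.
  apply (is_Cderive2_Cauchy f ((1 + Cmod z) / 2)); [exact Hf | lra | lra].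
Qed.

Lemma Cmult_cancel_l (c u v : C) : c <> RtoC 0 -> (c * u = c * v)%C -> u = v.
Proof.
  intros N E. rewrite <- (Cmult_1_l u), <- (Cmult_1_l v), <- (Cinv_l c N), <- !Cmult_assoc, E. reflexivity.
Qed.

Lemma circ_neq_0 (r t : R) : 0 < r -> circ r t <> RtoC 0.
Proof. intros Hr. apply Cmod_gt_0. rewrite Cmod_circ; lra. Qed.

(** With the next two lemmas: the Taylor coefficients at 0 of order 1, 2 and 0 as Fourier
    coefficients of [f] on a circle. *)
Lemma C_derive_0_integral (f : C -> C) (r : R) :
  analytic_on_disk f -> 0 < r < 1 ->
  CInt (fun t => f (circ r t) * / circ r t)%C 0 (2 * PI) = (RtoC (2 * PI) * C_derive f (RtoC 0))%C.
Proof.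
  intros Hf Hr.
  rewrite (C_derive_eq _ _ _ (is_Cderive_Cauchy f r (RtoC 0) Hf (proj2 Hr) ltac:(rewrite Cmod_0; lra))).
  rewrite Cmult_assoc, Cinv_r, Cmult_1_l by exact two_PI_neq_0.
  apply CInt_ext. intros t _. assert (N := circ_neq_0 r t (proj1 Hr)).
  replace (circ r t - RtoC 0)%C with (circ r t) by ring. simpl. field. exact N.
Qed.

Lemma C_derive2_0_integral (f : C -> C) (r : R) :
  analytic_on_disk f -> 0 < r < 1 ->
  CInt (fun t => f (circ r t) * / (circ r t * circ r t))%C 0 (2 * PI)
    = (RtoC (2 * PI) * (C_derive (C_derive f) (RtoC 0) / RtoC 2))%C.
Proof.
  intros Hf Hr.
  rewrite (C_derive_eq _ _ _ (is_Cderive2_Cauchy f r (RtoC 0) Hf (proj2 Hr) ltac:(rewrite Cmod_0; lra))).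
  transitivity (cauchy_kernel (fun t => circ r t * f (circ r t))%C r 3 (RtoC 0)).
  - apply CInt_ext. intros t _. assert (N := circ_neq_0 r t (proj1 Hr)).
    replace (circ r t - RtoC 0)%C with (circ r t) by ring. simpl. field. exact N.
  - field. exact two_PI_neq_0.
Qed.

Lemma C_value_0_integral (f : C -> C) (r : R) :
  analytic_on_disk f -> 0 < r < 1 ->
  CInt (fun t => f (circ r t)) 0 (2 * PI) = (RtoC (2 * PI) * f (RtoC 0))%C.
Proof.
  intros Hf Hr. rewrite <- (Cauchy_formula f r) by (try rewrite Cmod_0; lra || exact Hf).
  apply CInt_ext. intros t _. assert (N := circ_neq_0 r t (proj1 Hr)).
  replace (circ r t - RtoC 0)%C with (circ r t) by ring. simpl. field. exact N.
Qed.

(** Removable singularity. From u / (u - y) - 1 = y / (u - y), Cauchy's formula at y minus the mean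
    value at 0 shows that the quotient is, near 0, the average of f(u) / (u - y) over a circle,
    which is differentiable in y. *)
Lemma analytic_diff_quot_0 (f : C -> C) : analytic_on_disk f -> analytic_on_disk (diff_quot f (RtoC 0)).
Proof.
  intros Hf z Hz. destruct (Ceq_dec z (RtoC 0)) as [->|N].
  2:{ apply (ex_Cderive_diff_quot f _ z N (Hf z Hz)). }
  set (r := / 2). eexists.
  assert (Hk : forall y, Cmod y < r ->
    CInt (fun t => f (circ r t) * / (circ r t - y))%C 0 (2 * PI)
    = cauchy_kernel (fun t => f (circ r t)) r 1 y).
  { intros y Hy. apply CInt_ext. intros t _. simpl. rewrite Cmult_1_r. reflexivity. }
  assert (Hcont : continuous_between (fun t => f (circ r t)) 0 (2 * PI)).
  { apply continuous_on_circle; [exact Hf | unfold r; lra]. }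
  apply (is_Cderive_ext_near (fun y => / RtoC (2 * PI) * cauchy_kernel (fun t => f (circ r t)) r 1 y)%C _ _ _ r).
  - unfold r; lra.
  - intros y Hy. replace (y - RtoC 0)%C with y in Hy by ring.
    unfold diff_quot. destruct Ceq_dec as [->|N].
    + rewrite (C_derive_eq _ _ _ (is_Cderive_Cauchy f r (RtoC 0) Hf ltac:(unfold r; lra) Hy)).
      f_equal. apply CInt_ext. intros t _. assert (N := circ_neq_0 r t ltac:(unfold r; lra)).
      replace (circ r t - RtoC 0)%C with (circ r t) by ring. simpl. field. exact N.
    + apply (Cmult_cancel_l (RtoC (2 * PI) * y)); [apply Cmult_neq_0; [exact two_PI_neq_0 | exact N]|].
      transitivity (y * cauchy_kernel (fun t => f (circ r t)) r 1 y)%C; [field; exact two_PI_neq_0|].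
      transitivity (RtoC (2 * PI) * f y - RtoC (2 * PI) * f (RtoC 0))%C.
      2:{ replace (y - RtoC 0)%C with y by ring. field. exact N. }
      rewrite <- (Cauchy_formula f r y Hf ltac:(unfold r; lra) Hy).
      rewrite <- (C_value_0_integral f r Hf ltac:(unfold r; lra)).
      unfold cauchy_kernel. rewrite <- CInt_minus.
      * rewrite <- CInt_scal by (apply continuous_cauchy_kernel; assumption).
        apply CInt_ext. intros t _. assert (M := circ_minus_neq_0 r t y Hy). simpl. field. exact M.
      * apply continuous_cauchy_kernel; [exact Hy | apply continuous_circ_times; [exact Hf | unfold r; lra]].
      * exact Hcont.
  - apply is_Cderive_scal, is_Cderive_cauchy_kernel_1; [exact Hcont | rewrite Cmod_0; unfold r; lra].
Qed.

(** * The second coefficient of a Schwarz function *)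

Lemma CInt_Re_nonneg (f : R -> C) (a b : R) :
  a <= b -> continuous_between f a b -> (forall t, 0 <= Re (f t)) -> 0 <= Re (CInt f a b).
Proof.
  intros Hab Hc H. unfold CInt; simpl. apply RInt_ge_0; [exact Hab| |intros; apply H].
  apply (ex_RInt_continuous (V := R_CompleteNormedModule)).
  intros t Ht. apply continuous_Cfst, Hc, Ht.
Qed.

Lemma Cmod_plus_sqr (x y : C) :
  Cmod (x + y) ^ 2 = Cmod x ^ 2 + Cmod y ^ 2 + 2 * Re (x * Cconj y).
Proof. rewrite !Cmod2_alt. destruct x, y; simpl. ring. Qed.

Lemma Re_mult_le (w p q : C) :
  Cmod w <= 1 -> Re (w * (p * q)) <= / 2 * (Cmod p ^ 2 + Cmod q ^ 2).
Proof.
  intros Hw. eapply Rle_trans; [apply Rle_abs|]. eapply Rle_trans; [apply re_le_Cmod|].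
  rewrite !Cmod_mult. assert (P1 := Cmod_ge_0 p). assert (P2 := Cmod_ge_0 q). assert (P3 := Cmod_ge_0 w).
  assert (0 <= Cmod p * Cmod q) by nra.
  assert (0 <= (Cmod p - Cmod q) ^ 2) by apply pow2_ge_0. nra.
Qed.

Lemma CInt_circ (r : R) : CInt (circ r) 0 (2 * PI) = RtoC 0.
Proof.
  rewrite <- (circle_integral_primitive (fun z => z) (fun _ => RtoC 1) r).
  - apply CInt_ext. intros; ring.
  - intros t. apply is_Cderive_id.
  - intros t. apply continuous_const.
Qed.

Lemma circ_scal (r t : R) : circ r t = (RtoC r * circ 1 t)%C.
Proof. unfold circ, Cmult, RtoC; simpl. f_equal; ring. Qed.

Lemma Cconj_circ_1 (t : R) : Cconj (circ 1 t) = (/ circ 1 t)%C.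
Proof.
  assert (N := circ_neq_0 1 t Rlt_0_1).
  apply (Cmult_cancel_l (circ 1 t) _ _ N). rewrite Cinv_r by exact N.
  rewrite <- Cmod2_conj, Cmod_circ by lra. rewrite pow1. reflexivity.
Qed.

Lemma Cmod_self (z : C) : exists u : C, Cmod u = 1 /\ z = (RtoC (Cmod z) * u)%C.
Proof.
  destruct (Ceq_dec z (RtoC 0)) as [->|N].
  - exists (RtoC 1). rewrite Cmod_1, Cmod_0. split; [reflexivity | ring].
  - assert (P : RtoC (Cmod z) <> RtoC 0).
    { intros E. apply RtoC_inj in E. apply N, Cmod_eq_0, E. }
    exists (z / RtoC (Cmod z))%C. split.
    + rewrite Cmod_div, Cmod_R, Rabs_pos_eq by (apply Cmod_ge_0 || exact P).
      apply Rinv_r. intros E. apply P. rewrite E. reflexivity.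
    + field. exact P.
Qed.

(* Average of [Re (w p q^bar) <= (|p|^2 + |q|^2) / 2] over the circle of radius [r],
   with [p = 1 + b e], [q = d e + g e^2] and [e = exp (i t)]. *)
Lemma schwarz_bilinear (w : C -> C) (r : R) (b d g : C) :
  analytic_on_disk w -> (forall z, in_disk z -> in_disk (w z)) -> w (RtoC 0) = RtoC 0 -> 0 < r < 1 ->
  Re ((Cconj d + b * Cconj g) * (RtoC r * C_derive w (RtoC 0))
      + Cconj g * (RtoC (r * r) * (C_derive (C_derive w) (RtoC 0) / RtoC 2)))
  <= / 2 * (1 + Cmod b ^ 2 + Cmod d ^ 2 + Cmod g ^ 2).
Proof.
  intros Hw Hd H0 Hr.
  set (X := ((Cconj d + b * Cconj g) * (RtoC r * C_derive w (RtoC 0))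
      + Cconj g * (RtoC (r * r) * (C_derive (C_derive w) (RtoC 0) / RtoC 2)))%C).
  set (S := / 2 * (1 + Cmod b ^ 2 + Cmod d ^ 2 + Cmod g ^ 2)).
  assert (Hcw : continuous_between (fun t => w (circ r t)) 0 (2 * PI)).
  { apply continuous_on_circle; [exact Hw | lra]. }
  assert (Hcinv : continuous_between (fun t => / circ r t)%C 0 (2 * PI)).
  { intros t _. apply continuous_Cinv; [apply continuous_circ | apply circ_neq_0; lra]. }
  (* [h + k] is w p q^bar expanded in powers of e. The mean of [h] is the coefficient expression
     [X], and the mean of [k] vanishes because w(0) = 0. The real part of [m] is (|p|^2 + |q|^2) /
     2, and its mean is [S]. *)
  set (h := fun t => (((Cconj d + b * Cconj g) * RtoC r) * (w (circ r t) * / circ r t)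
     + (Cconj g * RtoC (r * r)) * (w (circ r t) * / (circ r t * circ r t)))%C).
  set (k := fun t => (b * Cconj d * w (circ r t))%C).
  set (m := fun t => (RtoC S + (b + Cconj d * g) * circ 1 t)%C).
  assert (C1 : continuous_between (fun t => w (circ r t) * / circ r t)%C 0 (2 * PI)).
  { intros t Ht. apply continuous_Cmult; auto. }
  assert (C2 : continuous_between (fun t => w (circ r t) * / (circ r t * circ r t))%C 0 (2 * PI)).
  { intros t Ht. apply continuous_Cmult; [auto|]. apply continuous_Cinv.
    - apply continuous_Cmult; apply continuous_circ.
    - apply Cmult_neq_0; apply circ_neq_0; lra. }
  assert (Ch : continuous_between h 0 (2 * PI)).
  { intros t Ht. apply continuous_Cplus; (apply continuous_Cmult; [apply continuous_const | auto]). }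
  assert (Ck : continuous_between k 0 (2 * PI)).
  { intros t Ht. apply continuous_Cmult; [apply continuous_const | auto]. }
  assert (Cm : continuous_between m 0 (2 * PI)).
  { intros t Ht. apply continuous_Cplus; [apply continuous_const|].
    apply continuous_Cmult; [apply continuous_const | apply continuous_circ]. }
  assert (Ih : CInt h 0 (2 * PI) = (RtoC (2 * PI) * X)%C).
  { unfold h. rewrite CInt_plus by (intros t Ht; apply continuous_Cmult; [apply continuous_const | auto]).
    rewrite !CInt_scal by assumption.
    rewrite C_derive_0_integral, C_derive2_0_integral by assumption. unfold X. ring. }
  assert (Ik : CInt k 0 (2 * PI) = RtoC 0).
  { unfold k. rewrite CInt_scal by assumption. rewrite C_value_0_integral, H0 by assumption. ring. }
  assert (Im : CInt m 0 (2 * PI) = RtoC (2 * PI * S)).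
  { unfold m. rewrite (CInt_plus (fun _ => RtoC S)).
    - rewrite CInt_const, CInt_scal by apply continuous_circ_between.
      rewrite CInt_circ, Rminus_0_r, (RtoC_mult (2 * PI) S). ring.
    - intros t _. apply continuous_const.
    - intros t _. apply continuous_Cmult; [apply continuous_const | apply continuous_circ]. }
  assert (Q : 0 <= Re (CInt (fun t => m t - (h t + k t))%C 0 (2 * PI))).
  { apply CInt_Re_nonneg; [apply two_PI_ge_0| |].
    - intros t Ht. apply continuous_Cminus; [apply Cm, Ht|]. apply continuous_Cplus; auto.
    - intros t. set (e := circ 1 t).
      assert (Ne : e <> RtoC 0) by (apply circ_neq_0; lra).
      assert (He : Cmod e = 1) by (apply Cmod_circ; lra).
      assert (Nr : RtoC r <> RtoC 0) by (intros E; apply RtoC_inj in E; lra).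
      assert (E : (h t + k t)%C = (w (circ r t) * ((RtoC 1 + b * e) * (Cconj e * (Cconj (d + g * e)))))%C).
      { unfold h, k. rewrite Cplus_conj, Cmult_conj. unfold e at 2 3. rewrite Cconj_circ_1. fold e.
        rewrite !(circ_scal r t). fold e. rewrite RtoC_mult. field. split; assumption. }
      assert (B := Re_mult_le (w (circ r t)) (RtoC 1 + b * e) (Cconj e * (Cconj (d + g * e)))
        (Rlt_le _ _ (Hd _ (circ_in_disk r t (conj (Rlt_le _ _ (proj1 Hr)) (proj2 Hr)))))).
      rewrite <- E in B. rewrite Cmod_mult, !Cmod_conj, He, Rmult_1_l in B.
      rewrite !Cmod_plus_sqr, !Cmod_mult, He, Cmod_1, !Rmult_1_r in B.
      assert (Re (m t) = S + Re (RtoC 1 * Cconj (b * e)) + Re (d * Cconj (g * e))).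
      { unfold m. fold e. destruct b, d, g, e; simpl. ring. }
      assert (Re (m t - (h t + k t)) = Re (m t) - Re (h t + k t)).
      { destruct (m t), (h t), (k t); simpl. ring. }
      unfold S in *. lra. }
  rewrite CInt_minus, CInt_plus, Ih, Ik, Im in Q; auto.
  2:{ intros t Ht. apply continuous_Cplus; auto. }
  replace (Re (RtoC (2 * PI * S) - (RtoC (2 * PI) * X + RtoC 0))) with (2 * PI * (S - Re X)) in Q
    by (destruct X; simpl; ring).
  assert (HPI := PI_RGT_0). nra.
Qed.

(* [q] is chosen as the degree <= 2 part of [w p]; [b = r c1^bar u], where
   [c2 = |c2| u], aligns the two terms of its [e^2] coefficient. *)
Lemma schwarz_second_coef (w : C -> C) :
  analytic_on_disk w -> (forall z, in_disk z -> in_disk (w z)) -> w (RtoC 0) = RtoC 0 ->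
  Cmod (C_derive (C_derive w) (RtoC 0) / RtoC 2) <= 1 - Cmod (C_derive w (RtoC 0)) ^ 2.
Proof.
  intros Hw Hd H0.
  set (c1 := C_derive w (RtoC 0)). set (c2 := (C_derive (C_derive w) (RtoC 0) / RtoC 2)%C).
  assert (K : forall r, 0 < r < 1 -> r * r * (Cmod c2 + Cmod c1 ^ 2) <= 1).
  { intros r Hr. destruct (Cmod_self c2) as [u [Hu Ec2]].
    set (s := r * r * (Cmod c2 + Cmod c1 ^ 2)).
    assert (B := schwarz_bilinear w r (RtoC r * Cconj c1 * u) (RtoC r * c1) (RtoC s * u) Hw Hd H0 Hr).
    fold c1 c2 in B. rewrite !Cmod_mult, Cmod_conj, Hu, !Cmod_R, !Rmult_1_r in B.
    rewrite !Rpow_mult_distr, !pow2_abs in B.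
    (* The phases cancel and the left side is r^2 |c1|^2 + s^2. The right side is half of 1 + 2 r^2
       |c1|^2 + s^2, so what remains is s^2 <= 1. *)
    match type of B with Re ?X <= _ => assert (E : X = RtoC (r ^ 2 * Cmod c1 ^ 2 + s ^ 2)) end.
    { rewrite Ec2. rewrite !Cmult_conj.
      assert (U : (u * Cconj u)%C = RtoC 1).
      { rewrite <- Cmod2_conj, Hu, pow1. reflexivity. }
      assert (V : (c1 * Cconj c1)%C = RtoC (Cmod c1 ^ 2)) by (symmetry; apply Cmod2_conj).
      replace (Cconj (RtoC r)) with (RtoC r) by (unfold Cconj, RtoC; simpl; f_equal; ring).
      replace (Cconj (RtoC s)) with (RtoC s) by (unfold Cconj, RtoC; simpl; f_equal; ring).
      transitivity (RtoC r * RtoC r * (c1 * Cconj c1)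
        + RtoC r * RtoC r * RtoC s * (c1 * Cconj c1) * (u * Cconj u)
        + RtoC s * RtoC (r * r) * RtoC (Cmod c2) * (u * Cconj u))%C; [ring|].
      rewrite U, V, !Cmult_1_r, <- !RtoC_mult, <- !RtoC_plus. f_equal. unfold s. ring. }
    rewrite E in B. simpl Re in B. nra. }
  set (S := Cmod c2 + Cmod c1 ^ 2) in *. enough (S <= 1) by (unfold S in *; lra).
  apply Rnot_lt_le. intros HS.
  (* The limit r -> 1 by contradiction: with r = 1 - e, r^2 S >= S - 2 e S = (S + 1) / 2 > 1. *)
  set (e := (S - 1) / (4 * S)).
  assert (He : 0 < e < 1).
  { unfold e. split; [apply Rdiv_lt_0_compat; lra | apply Rlt_div_l; lra]. }
  assert (HeS : e * S = (S - 1) / 4) by (unfold e; field; lra).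
  specialize (K (1 - e) ltac:(lra)). nra.
Qed.

(** * Coefficients of functions in the class *)

Lemma in_disk_0 : in_disk (RtoC 0).
Proof. unfold in_disk. rewrite Cmod_0. lra. Qed.

Lemma is_Cderive_disk_ext (g h : C -> C) (z l : C) :
  (forall y, in_disk y -> g y = h y) -> in_disk z -> is_Cderive g z l -> is_Cderive h z l.
Proof.
  intros E Hz. apply (is_Cderive_ext_near _ _ _ _ (1 - Cmod z)); [unfold in_disk in Hz; lra|].
  intros y Hy. apply E. exact (near_radius 1 z y Hy).
Qed.

(** The means of differentiating both sides of an identity that holds on the disk. *)
Lemma is_Cderive_disk_unique (g h : C -> C) (z l l' : C) :
  (forall y, in_disk y -> g y = h y) -> in_disk z -> is_Cderive g z l -> is_Cderive h z l' -> l = l'.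
Proof.
  intros E Hz Hg Hh. rewrite <- (C_derive_eq _ _ _ Hh).
  symmetry. apply C_derive_eq. exact (is_Cderive_disk_ext g h z l E Hz Hg).
Qed.

Lemma analytic_is_Cderive (f : C -> C) (z : C) :
  analytic_on_disk f -> in_disk z -> is_Cderive f z (C_derive f z).
Proof. intros Hf Hz. apply is_Cderive_C_derive, Hf, Hz. Qed.

(** Without division, z f' = f P also holds at 0 and can be differentiated. At 0 the second
    derivative gives 2 f'' = f'' + 2 P', and the third gives 3 f''' = f''' + 3 f'' P' + 3 P''. *)
Lemma log_derivative_coefs (f P : C -> C) :
  analytic_on_disk f -> analytic_on_disk P ->
  (forall z, in_disk z -> (z * C_derive f z)%C = (f z * P z)%C) ->
  f (RtoC 0) = RtoC 0 -> C_derive f (RtoC 0) = RtoC 1 -> P (RtoC 0) = RtoC 1 ->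
  let P1 := C_derive P (RtoC 0) in
  C_derive (C_derive f) (RtoC 0) = (RtoC 2 * P1)%C /\
  C_derive (C_derive (C_derive f)) (RtoC 0)
    = (RtoC 3 * (P1 * P1) + RtoC 3 / RtoC 2 * C_derive (C_derive P) (RtoC 0))%C.
Proof.
  intros Hf HP E f0 f1 P0.
  assert (Hf1 := analytic_C_derive f Hf). assert (Hf2 := analytic_C_derive _ Hf1).
  assert (HP1 := analytic_C_derive P HP).
  assert (E1 : forall z, in_disk z -> (C_derive f z + z * C_derive (C_derive f) z)%C
    = (C_derive f z * P z + f z * C_derive P z)%C).
  { intros z Hz. eapply is_Cderive_disk_unique; [exact E | exact Hz | |].
    - eapply is_Cderive_eq.
      + apply is_Cderive_mult; [apply is_Cderive_id | apply analytic_is_Cderive; assumption].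
      + simpl. ring.
    - apply is_Cderive_mult; apply analytic_is_Cderive; assumption. }
  assert (E2 : forall z, in_disk z ->
    (RtoC 2 * C_derive (C_derive f) z + z * C_derive (C_derive (C_derive f)) z)%C
    = (C_derive (C_derive f) z * P z + RtoC 2 * (C_derive f z * C_derive P z) + f z * C_derive (C_derive P) z)%C).
  { intros z Hz. eapply is_Cderive_disk_unique; [exact E1 | exact Hz | |].
    - eapply is_Cderive_eq.
      + apply is_Cderive_plus; [apply analytic_is_Cderive; assumption|].
        apply is_Cderive_mult; [apply is_Cderive_id | apply analytic_is_Cderive; assumption].
      + simpl. ring.
    - eapply is_Cderive_eq.
      + apply is_Cderive_plus; apply is_Cderive_mult; apply analytic_is_Cderive; assumption.
      + simpl. ring. }
  assert (E3 : (RtoC 3 * C_derive (C_derive (C_derive f)) (RtoC 0))%C =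
    (C_derive (C_derive (C_derive f)) (RtoC 0) * P (RtoC 0)
     + RtoC 3 * (C_derive (C_derive f) (RtoC 0) * C_derive P (RtoC 0))
     + RtoC 3 * (C_derive f (RtoC 0) * C_derive (C_derive P) (RtoC 0))
     + f (RtoC 0) * C_derive (C_derive (C_derive P)) (RtoC 0))%C).
  { assert (HP2 := analytic_C_derive _ HP1).
    assert (D := in_disk_0).
    eapply is_Cderive_disk_unique; [exact E2 | exact D | |].
    - eapply is_Cderive_eq.
      + apply is_Cderive_plus; [apply is_Cderive_scal, analytic_is_Cderive; assumption|].
        apply is_Cderive_mult; [apply is_Cderive_id | apply analytic_is_Cderive; [apply analytic_C_derive|]; assumption].
      + simpl. ring.
    - eapply is_Cderive_eq.
      + apply is_Cderive_plus; [apply is_Cderive_plus|].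
        * apply is_Cderive_mult; apply analytic_is_Cderive; assumption.
        * apply is_Cderive_scal, is_Cderive_mult; apply analytic_is_Cderive; assumption.
        * apply is_Cderive_mult; apply analytic_is_Cderive; assumption.
      + simpl. ring. }
  specialize (E2 _ in_disk_0). rewrite f0, f1, P0 in E2, E3.
  cbn zeta.
  set (P1 := C_derive P (RtoC 0)) in *. set (f2 := C_derive (C_derive f) (RtoC 0)) in *.
  set (f3 := C_derive (C_derive (C_derive f)) (RtoC 0)) in *. set (P2 := C_derive (C_derive P) (RtoC 0)) in *.
  assert (A : f2 = (RtoC 2 * P1)%C).
  { replace f2 with ((RtoC 2 * f2 + RtoC 0 * f3) - f2)%C by ring. rewrite E2. ring. }
  split; [exact A|].
  replace f3 with ((RtoC 3 * f3 - f3) / RtoC 2)%C by field.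
  rewrite E3, A. field.
Qed.

Lemma taylor_coef_1 (f : C -> C) : taylor_coef f 1 = C_derive f (RtoC 0).
Proof. unfold taylor_coef. simpl. field. Qed.

Lemma taylor_coef_2 (f : C -> C) : taylor_coef f 2 = (C_derive (C_derive f) (RtoC 0) / RtoC 2)%C.
Proof. unfold taylor_coef. replace (INR (fact 2)) with 2 by (simpl; ring). reflexivity. Qed.

Lemma taylor_coef_3 (f : C -> C) :
  taylor_coef f 3 = (C_derive (C_derive (C_derive f)) (RtoC 0) / RtoC 6)%C.
Proof. unfold taylor_coef. replace (INR (fact 3)) with 6 by (simpl; ring). reflexivity. Qed.

Lemma taylor_coef_0 (f : C -> C) : taylor_coef f 0 = f (RtoC 0).
Proof. unfold taylor_coef. simpl. field. Qed.

Lemma starlike_coefs (phi f w : C -> C) :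
  analytic_on_disk phi -> phi (RtoC 0) = RtoC 1 ->
  class_S f -> analytic_on_disk w -> (forall z, in_disk z -> in_disk (w z)) ->
  w (RtoC 0) = RtoC 0 ->
  (forall z, in_disk z -> starlike_quotient f z = phi (w z)) ->
  let B1 := taylor_coef phi 1 in let B2 := taylor_coef phi 2 in
  let c1 := taylor_coef w 1 in let c2 := taylor_coef w 2 in
  taylor_coef f 2 = (B1 * c1)%C /\
  taylor_coef f 3 = ((B1 * c2 + (B2 + B1 * B1) * (c1 * c1)) / RtoC 2)%C.
Proof.
  intros Hphi phi0 [[Hf [f0 f1]] Huni] Hw Hd w0 E.
  rewrite taylor_coef_0 in f0. rewrite taylor_coef_1 in f1.
  set (P := fun z => phi (w z)).
  assert (DP : forall z, in_disk z -> is_Cderive P z (C_derive w z * C_derive phi (w z))%C).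
  { intros z Hz. apply (is_Cderive_comp phi w); apply analytic_is_Cderive; auto. }
  assert (HP : analytic_on_disk P) by (intros z Hz; eexists; apply DP, Hz).
  assert (D0 := in_disk_0).
  assert (P1 : C_derive P (RtoC 0) = (C_derive w (RtoC 0) * C_derive phi (RtoC 0))%C).
  { rewrite (C_derive_eq _ _ _ (DP _ D0)), w0. reflexivity. }
  assert (P2 : C_derive (C_derive P) (RtoC 0) =
    (C_derive (C_derive w) (RtoC 0) * C_derive phi (RtoC 0)
     + C_derive w (RtoC 0) * (C_derive w (RtoC 0) * C_derive (C_derive phi) (RtoC 0)))%C).
  { apply C_derive_eq.
    apply (is_Cderive_disk_ext (fun z => C_derive w z * C_derive phi (w z))%C); [|exact D0|].
    - intros z Hz. symmetry. apply C_derive_eq, DP, Hz.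
    - assert (M := is_Cderive_mult (C_derive w) (fun z => C_derive phi (w z)) (RtoC 0) _ _
        (analytic_is_Cderive _ _ (analytic_C_derive w Hw) D0)
        (is_Cderive_comp (C_derive phi) w (RtoC 0) _ _
          (analytic_is_Cderive _ _ (analytic_C_derive phi Hphi) (Hd _ D0))
          (analytic_is_Cderive _ _ Hw D0))).
      cbv beta in M. rewrite w0 in M. exact M. }
  destruct (log_derivative_coefs f P Hf HP) as [A2 A3]; auto.
  - intros z Hz. specialize (E z Hz). unfold starlike_quotient in E.
    destruct Ceq_dec as [->|N].
    + rewrite f0. ring.
    (* The denominator is nonzero: f(0) = 0 and univalence exclude another zero. *)
    + unfold P. rewrite <- E. field. intros F. apply N, Huni; auto. congruence.
  - unfold P. rewrite w0. exact phi0.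
  - cbn zeta. rewrite taylor_coef_3, !taylor_coef_2, !taylor_coef_1, A2, A3, P1, P2.
    split; field.
Qed.

Lemma toeplitz_det_3_1 (f : C -> C) :
  taylor_coef f 1 = RtoC 1 ->
  let a2 := taylor_coef f 2 in let a3 := taylor_coef f 3 in
  toeplitz_det f 3 1 = (RtoC 1 - RtoC 2 * (a2 * a2) + a3 * (RtoC 2 * (a2 * a2) - a3))%C.
Proof.
  intros a1. unfold toeplitz_det. cbn [det]. repeat (rewrite sum_Sn || rewrite sum_O).
  cbn [Nat.ltb Nat.leb Nat.sub Nat.add]. rewrite a1. unfold plus; simpl. ring.
Qed.

(** The bound B (1 - x) + |q| x with x = |c1|^2 <= 1 is largest at x = 1, because B <= |q|. *)
Lemma coef_combination_bound (c1 c2 : C) (B q : R) :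
  0 <= B -> B <= Rabs q -> Cmod c2 <= 1 - Cmod c1 ^ 2 ->
  Cmod ((RtoC B * c2 + RtoC q * (c1 * c1)) / RtoC 2) <= Rabs q / 2.
Proof.
  intros HB Hq Hc.
  assert (N2 : RtoC 2 <> RtoC 0) by (intros E; apply RtoC_inj in E; lra).
  rewrite Cmod_div by exact N2. rewrite Cmod_R, (Rabs_pos_eq 2) by lra.
  apply Rmult_le_compat_r; [lra|].
  eapply Rle_trans; [apply Cmod_triangle|]. rewrite !Cmod_mult, !Cmod_R, (Rabs_pos_eq B) by exact HB.
  assert (P1 := Cmod_ge_0 c1). assert (P2 := Cmod_ge_0 c2).
  assert (0 <= Cmod c1 ^ 2) by apply pow2_ge_0. nra.
Qed.

Lemma toeplitz_bound (phi f : C -> C) (B1 B2 : R) :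
  analytic_on_disk phi -> phi (RtoC 0) = RtoC 1 ->
  taylor_coef phi 1 = RtoC B1 -> taylor_coef phi 2 = RtoC B2 ->
  0 < B1 -> B1 - B1 ^ 2 <= B2 -> B2 <= 3 * B1 ^ 2 - B1 ->
  class_S_star phi f ->
  Cmod (toeplitz_det f 3 1) <= 1 + 2 * B1 ^ 2 + 1 / 4 * (B2 + B1 ^ 2) * (3 * B1 ^ 2 - B2).
Proof.
  intros Hphi phi0 E1 E2 HB1 L1 L2 [HS [w [Hw [Hd [w0 Hs]]]]].
  destruct (starlike_coefs phi f w Hphi phi0 HS Hw Hd w0 Hs) as [A2 A3].
  assert (Sch := schwarz_second_coef w Hw Hd w0).
  rewrite <- taylor_coef_2, <- taylor_coef_1 in Sch.
  rewrite E1 in A2. rewrite E1, E2 in A3.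
  rewrite toeplitz_det_3_1 by exact (proj2 (proj2 (proj1 HS))).
  set (a2 := taylor_coef f 2) in *. set (a3 := taylor_coef f 3) in *.
  set (c1 := taylor_coef w 1) in *. set (c2 := taylor_coef w 2) in *.
  (* Here q = B2 + B1^2, and the lower bound on [B2] says B1 <= q. *)
  assert (M3 : Cmod a3 <= (B2 + B1 ^ 2) / 2).
  { rewrite <- (Rabs_pos_eq (B2 + B1 ^ 2)) by nra.
    replace a3 with ((RtoC B1 * c2 + RtoC (B2 + B1 ^ 2) * (c1 * c1)) / RtoC 2)%C.
    - apply coef_combination_bound; [lra | rewrite Rabs_pos_eq; nra | exact Sch].
    - rewrite A3, RtoC_plus, RtoC_pow. simpl. field. }
  (* Subtracting 2 B1^2 c1^2 from a3 turns q into B2 - 3 B1^2; the upper bound on [B2] says B1 <=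
     |q|. *)
  assert (M4 : Cmod (RtoC 2 * (a2 * a2) - a3) <= (3 * B1 ^ 2 - B2) / 2).
  { rewrite <- Cmod_opp. rewrite <- (Rabs_pos_eq (3 * B1 ^ 2 - B2)) by nra. rewrite <- Rabs_Ropp.
    replace (- (RtoC 2 * (a2 * a2) - a3))%C
      with ((RtoC B1 * c2 + RtoC (- (3 * B1 ^ 2 - B2)) * (c1 * c1)) / RtoC 2)%C.
    - apply coef_combination_bound; [lra | rewrite Rabs_Ropp, Rabs_pos_eq; nra | exact Sch].
    - rewrite A2, A3, RtoC_opp, RtoC_minus, RtoC_mult, RtoC_pow. simpl. field. }
  assert (M2 : Cmod a2 <= B1).
  { rewrite A2, Cmod_mult, Cmod_R, Rabs_pos_eq by lra.
    assert (0 <= Cmod c1) by apply Cmod_ge_0. assert (0 <= Cmod c2) by apply Cmod_ge_0.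
    assert (Cmod c1 <= 1) by nra. nra. }
  unfold Cminus at 1.
  eapply Rle_trans; [apply Cmod_triangle|].
  rewrite (Cmod_mult a3).
  assert (M5 : Cmod (RtoC 1 + - (RtoC 2 * (a2 * a2))) <= 1 + 2 * B1 ^ 2).
  { eapply Rle_trans; [apply Cmod_triangle|]. rewrite Cmod_opp, !Cmod_mult, !Cmod_R.
    rewrite Rabs_R1, (Rabs_pos_eq 2) by lra.
    assert (0 <= Cmod a2) by apply Cmod_ge_0. nra. }
  assert (M6 : Cmod a3 * Cmod (RtoC 2 * (a2 * a2) - a3) <= (B2 + B1 ^ 2) / 2 * ((3 * B1 ^ 2 - B2) / 2)).
  { apply Rmult_le_compat; try apply Cmod_ge_0; assumption. }
  lra.
Qed.

(** * The extremal function *)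

Definition Cexp (z : C) : C := circ (exp (fst z)) (snd z).

Lemma Cmod_Cexp (z : C) : Cmod (Cexp z) = exp (Re z).
Proof. apply Cmod_circ. left. apply exp_pos. Qed.

Lemma Cexp_plus (z w : C) : Cexp (z + w) = (Cexp z * Cexp w)%C.
Proof.
  unfold Cexp, circ, Cmult, Cplus. cbn [fst snd]. rewrite exp_plus, cos_plus, sin_plus.
  f_equal; ring.
Qed.

Lemma Cexp_0 : Cexp (RtoC 0) = RtoC 1.
Proof. unfold Cexp, circ; simpl. rewrite exp_0, cos_0, sin_0. unfold RtoC. f_equal; ring. Qed.

Lemma Cexp_neq_0 (z : C) : Cexp z <> RtoC 0.
Proof. apply circ_neq_0, exp_pos. Qed.

Lemma Rabs_fst_le_Cmod (z : C) : Rabs (fst z) <= Cmod z.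
Proof. exact (Rle_trans _ _ _ (Rmax_l _ _) (Rmax_Cmod z)). Qed.

Lemma Rabs_snd_le_Cmod (z : C) : Rabs (snd z) <= Cmod z.
Proof. exact (Rle_trans _ _ _ (Rmax_r _ _) (Rmax_Cmod z)). Qed.

(** With u and v the first-order remainders of e^a and e^(i b), the remainder of e^(a + i b) is u
    e^(i b) + (1 + a) v + i a b. *)
Lemma is_Cderive_Cexp_0 : is_Cderive Cexp (RtoC 0) (RtoC 1).
Proof.
  apply is_Cderive_eps. intros eps He.
  assert (H1 : @is_derive R_AbsRing C_R_NormedModule (fun t => RtoC (exp t)) 0 (RtoC 1)).
  { apply is_derive_curve; cbn [fst snd RtoC]; auto_derive; auto. rewrite exp_0; ring. }
  assert (H2 := is_derive_circ 1 0).
  rewrite is_derive_curve_eps in H1, H2.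
  (* The budget: 1/6 for u, 2/6 for (1 + a) v with |1 + a| <= 2, and 1/2 for a b with |a| < eps /
     2. *)
  destruct (H1 (eps / 6)) as [d1 [Hd1 K1]]; [lra|].
  destruct (H2 (eps / 6)) as [d2 [Hd2 K2]]; [lra|].
  exists (Rmin (Rmin 1 (eps / 2)) (Rmin d1 d2)); split.
  { repeat apply Rmin_case; lra. }
  intros y Hy.
  assert (Hy1 : Cmod y < Rmin (Rmin 1 (eps / 2)) (Rmin d1 d2)).
  { replace y with (y - RtoC 0)%C by ring. exact Hy. }
  replace (y - RtoC 0)%C with y by ring. clear Hy.
  assert (M1 := Rlt_le_trans _ _ _ Hy1 (Rmin_l _ _)).
  assert (M2 := Rlt_le_trans _ _ _ Hy1 (Rmin_r _ _)).
  assert (B1 := Rlt_le_trans _ _ _ M1 (Rmin_l _ _)).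
  assert (B2 := Rlt_le_trans _ _ _ M1 (Rmin_r _ _)).
  assert (B3 := Rlt_le_trans _ _ _ M2 (Rmin_l _ _)).
  assert (B4 := Rlt_le_trans _ _ _ M2 (Rmin_r _ _)).
  assert (Fa := Rabs_fst_le_Cmod y). assert (Fb := Rabs_snd_le_Cmod y).
  specialize (K1 (fst y)). specialize (K2 (snd y)).
  rewrite Rminus_0_r in K1, K2. specialize (K1 ltac:(lra)). specialize (K2 ltac:(lra)).
  set (m := Cmod y) in *. destruct y as [a b]. cbn [fst snd] in *.
  rewrite exp_0 in K1.
  replace (circ 1 0) with (RtoC 1) in K2
    by (unfold circ, RtoC; rewrite cos_0, sin_0; f_equal; ring).
  rewrite Cexp_0.
  set (u := (RtoC (exp a) - RtoC 1 - RtoC a * RtoC 1)%C) in *.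
  set (v := (circ 1 b - RtoC 1 - RtoC b * (Ci * RtoC 1))%C) in *.
  replace (Cexp (a, b) - RtoC 1 - (a, b) * RtoC 1)%C
    with (u * circ 1 b + (RtoC (1 + a) * v + Ci * RtoC (a * b)))%C.
  2:{ unfold u, v, Cexp. cbn [fst snd]. rewrite (circ_scal (exp a) b).
      replace ((a, b) : C) with (RtoC a + Ci * RtoC b)%C
        by (unfold Cplus, Cmult, Ci, RtoC; simpl; f_equal; ring).
      rewrite RtoC_plus, RtoC_mult. ring. }
  eapply Rle_trans; [apply Cmod_triangle|].
  assert (T := Cmod_triangle (RtoC (1 + a) * v) (Ci * RtoC (a * b))).
  rewrite !Cmod_mult, Cmod_Ci, !Cmod_R, Rabs_mult in T.
  rewrite Cmod_mult, Cmod_circ by lra.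
  assert (A1 : Rabs (1 + a) <= 2).
  { eapply Rle_trans; [apply Rabs_triang|]. rewrite Rabs_R1. lra. }
  assert (P1 := Cmod_ge_0 v). assert (P2 := Rabs_pos a). assert (P3 := Rabs_pos b).
  assert (P4 := Rabs_pos (1 + a)).
  assert (Rabs (1 + a) * Cmod v <= 2 * (eps / 6 * Rabs b)) by (apply Rmult_le_compat; lra).
  assert (Rabs a * Rabs b <= eps / 2 * m) by (apply Rmult_le_compat; lra).
  nra.
Qed.

(** The functional equation carries the derivative from 0 to z. *)
Lemma is_Cderive_Cexp (z : C) : is_Cderive Cexp z (Cexp z).
Proof.
  apply (is_Cderive_ext_near (fun y => Cexp z * Cexp (y - z))%C _ _ _ 1 Rlt_0_1).
  - intros y _. rewrite <- Cexp_plus. f_equal. ring.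
  - eapply is_Cderive_eq.
    + apply is_Cderive_scal. apply (is_Cderive_comp Cexp (fun y => y - z)%C).
      * replace (z - z)%C with (RtoC 0) by ring. apply is_Cderive_Cexp_0.
      * apply is_Cderive_minus; [apply is_Cderive_id | apply is_Cderive_const].
    + simpl; ring.
Qed.

(** The modulus forces the real part to be 0. Then cos y = 1, and the half-angle formula gives sin
    (y / 2) = 0. *)
Lemma Cexp_eq_1 (z : C) : Cexp z = RtoC 1 -> exists k : Z, z = (0, (2 * IZR k * PI)%R).
Proof.
  intros E. assert (M : exp (Re z) = 1) by (rewrite <- Cmod_Cexp, E; apply Cmod_1).
  assert (Hx : Re z = 0) by (apply exp_inv; rewrite exp_0; exact M).
  destruct z as [x y]. unfold Re in Hx; cbn [fst] in Hx. subst x.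
  assert (Hc : cos y = 1).
  { apply (f_equal fst) in E. unfold Cexp, circ in E. cbn [fst snd RtoC] in E. rewrite exp_0 in E. lra. }
  assert (Hs : sin (y / 2) = 0).
  { assert (D := cos_2a_sin (y / 2)). replace (2 * (y / 2)) with y in D by field. nra. }
  destruct (sin_eq_0_0 _ Hs) as [k Hk]. exists k. f_equal. lra.
Qed.

Lemma Cexp_period (z : C) (k : Z) : Cexp (z + (0, (2 * IZR k * PI)%R)) = Cexp z.
Proof.
  assert (E : Cexp (0, (2 * IZR k * PI)%R) = RtoC 1).
  { unfold Cexp, circ; cbn [fst snd]. rewrite exp_0.
    assert (Hs : sin (IZR k * PI) = 0) by (apply sin_eq_0_1; exists k; reflexivity).
    replace (2 * IZR k * PI) with (2 * (IZR k * PI)) by ring.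
    rewrite cos_2a_sin, sin_2a, Hs. unfold RtoC. f_equal; ring. }
  rewrite Cexp_plus, E. ring.
Qed.

Lemma Cexp_eq (z w : C) : Cexp z = Cexp w -> exists k : Z, z = (w + (0, (2 * IZR k * PI)%R))%C.
Proof.
  intros E. destruct (Cexp_eq_1 (z - w)) as [k Hk].
  - apply (Cmult_cancel_l (Cexp w)); [apply Cexp_neq_0|].
    rewrite <- Cexp_plus. replace (w + (z - w))%C with z by ring. rewrite E. ring.
  - exists k. rewrite <- Hk. ring.
Qed.

Lemma Cexp_surjective (z : C) : z <> RtoC 0 -> exists s, Cexp s = z.
Proof.
  intros N. destruct (Cmod_self z) as [u [Hu E]].
  assert (Hz : 0 < Cmod z) by apply Cmod_gt_0, N.
  assert (K : exists t, circ 1 t = u).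
  { destruct u as [x y].
    assert (Q : x * x + y * y = 1).
    { apply (f_equal (fun v => v ^ 2)) in Hu. rewrite Cmod2_alt in Hu. simpl in Hu. lra. }
    assert (Hx : -1 <= x <= 1) by nra.
    assert (Hsq : sqrt (1 - x²) = Rabs y).
    { rewrite <- sqrt_Rsqr_abs. f_equal. unfold Rsqr. lra. }
    (* [acos] only reaches arguments in [0, pi]; the lower half of the circle takes the opposite
       argument. *)
    destruct (Rle_dec 0 y) as [Hy|Hy].
    - exists (acos x). unfold circ. rewrite cos_acos, sin_acos, Hsq, Rabs_pos_eq by assumption.
      f_equal; ring.
    - exists (- acos x). unfold circ. rewrite cos_neg, sin_neg, cos_acos, sin_acos, Hsq, Rabs_left by lra.
      f_equal; ring. }
  destruct K as [t Ht]. exists (ln (Cmod z), t). unfold Cexp; cbn [fst snd].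
  rewrite exp_ln, circ_scal, Ht by exact Hz. symmetry; exact E.
Qed.

(** With d = s - t, the real part of d^bar L along the segment from t to s has derivative |d|^2 Re
    L' > 0, so by the mean value theorem its end values differ. Convexity enters only as the segment
    lying in [D]. *)
Lemma Noshiro_Warschawski (D : C -> Prop) (L dL : C -> C) (s t : C) :
  (forall x, 0 <= x <= 1 -> D (t + RtoC x * (s - t))%C) ->
  (forall z, D z -> is_Cderive L z (dL z)) -> (forall z, D z -> 0 < Re (dL z)) ->
  L s = L t -> s = t.
Proof.
  intros HD HL Hpos E. destruct (Ceq_dec s t) as [|N]; [assumption|]. exfalso.
  set (d := (s - t)%C) in *. assert (Hd := Cminus_neq_0 _ _ N). fold d in Hd.
  set (q := fun x => fst (Cconj d * L (t + RtoC x * d))%C).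
  assert (Hq : forall x, 0 <= x <= 1 -> is_derive q x (Cmod d ^ 2 * Re (dL (t + RtoC x * d)%C))).
  { intros x Hx.
    replace (Cmod d ^ 2 * Re (dL (t + RtoC x * d)%C))
      with (fst (d * (Cconj d * dL (t + RtoC x * d)))%C).
    2:{ rewrite Cmult_assoc, <- Cmod2_conj. destruct (dL _). simpl. ring. }
    apply (is_derive_curve_fst (fun x => Cconj d * L (t + RtoC x * d))%C).
    apply (is_derive_curve_comp (fun z => Cconj d * L z)%C (fun x => t + RtoC x * d)%C).
    - apply is_Cderive_scal, HL, HD, Hx.
    - clear. destruct d as [d1 d2], t as [t1 t2].
      apply is_derive_curve; unfold Cmult, Cplus, RtoC; cbn [fst snd]; auto_derive; auto; ring. }
  destruct (MVT_gen q 0 1 (fun x => Cmod d ^ 2 * Re (dL (t + RtoC x * d)%C))) as [c [Hc Ec]].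
  - intros x Hx. rewrite Rmin_left, Rmax_right in Hx by lra. apply Hq. lra.
  - intros x Hx. rewrite Rmin_left, Rmax_right in Hx by lra.
    apply continuity_pt_filterlim, (ex_derive_continuous (V := R_NormedModule)).
    eexists. apply Hq, Hx.
  - rewrite Rmin_left, Rmax_right in Hc by lra.
    assert (Z : q 1 - q 0 = 0).
    { unfold q. replace (t + RtoC 1 * d)%C with s by (unfold d; ring).
      replace (t + RtoC 0 * d)%C with t by ring. rewrite E. ring. }
    rewrite Z in Ec. apply Cmod_gt_0 in Hd.
    assert (P := Hpos _ (HD c Hc)). assert (0 < Cmod d ^ 2) by (apply pow_lt, Hd). nra.
Qed.

(* With [z = exp s] the logarithm of the function is [s + G (exp s)], whose derivative
   [psi (exp s)] has positive real part on the left half-plane. *)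
Lemma starlike_univalent (psi G : C -> C) :
  (forall z, in_disk z -> 0 < Re (psi z)) ->
  (forall z, in_disk z -> exists h, is_Cderive G z h /\ (RtoC 1 + z * h)%C = psi z) ->
  univalent_on_disk (fun z => z * Cexp (G z))%C.
Proof.
  intros Hpsi HG z1 z2 D1 D2 E.
  (* The origin has no logarithm. It is separated from the other points because z exp G vanishes
     only there. *)
  destruct (Ceq_dec z1 (RtoC 0)) as [->|N1].
  { destruct (Ceq_dec z2 (RtoC 0)) as [->|N2]; [reflexivity|].
    exfalso. apply (Cmult_neq_0 _ _ N2 (Cexp_neq_0 (G z2))). rewrite <- E. ring. }
  destruct (Ceq_dec z2 (RtoC 0)) as [->|N2].
  { exfalso. apply (Cmult_neq_0 _ _ N1 (Cexp_neq_0 (G z1))). rewrite E. ring. }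
  destruct (Cexp_surjective z1 N1) as [s1 E1]. destruct (Cexp_surjective z2 N2) as [s2 E2].
  assert (Hdisk : forall s, in_disk (Cexp s) <-> Re s < 0).
  { intros s. unfold in_disk. rewrite Cmod_Cexp. split; intros H.
    - apply exp_lt_inv. rewrite exp_0. exact H.
    - rewrite <- exp_0. apply exp_increasing, H. }
  set (L := fun s => (s + G (Cexp s))%C).
  rewrite <- E1, <- E2 in E. rewrite <- !Cexp_plus in E.
  destruct (Cexp_eq _ _ E) as [k Hk].
  (* Moving s2 by the period found above keeps exp s2, hence G, and turns the congruence modulo 2 pi
     i into the equality L s1 = L s2'. *)
  set (s2' := (s2 + (0, (2 * IZR k * PI)%R))%C).
  assert (P2 : Cexp s2' = Cexp s2) by apply Cexp_period.
  rewrite <- E1, <- E2, <- P2. f_equal.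
  apply (Noshiro_Warschawski (fun s => Re s < 0) L (fun s => psi (Cexp s))).
  - rewrite <- E1 in D1. rewrite <- E2, <- P2 in D2. apply Hdisk in D1, D2. clear - D1 D2.
    intros x Hx. destruct s1, s2'. simpl in *. nra.
  - intros s Hs. apply Hdisk in Hs. destruct (HG _ Hs) as [h [Hh <-]].
    apply is_Cderive_plus; [apply is_Cderive_id|].
    apply (is_Cderive_comp G Cexp); [exact Hh | apply is_Cderive_Cexp].
  - intros s Hs. apply Hpsi, Hdisk, Hs.
  - unfold L. rewrite P2, Hk. unfold s2'. ring.
Qed.

(** * Construction of the function belonging to w = i z *)

Lemma rotation_in_disk (z : C) : in_disk z -> in_disk (Ci * z)%C.
Proof. unfold in_disk. rewrite Cmod_mult, Cmod_Ci, Rmult_1_l. auto. Qed.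

Lemma is_Cderive_rotation (z : C) : is_Cderive (fun x => Ci * x)%C z Ci.
Proof. eapply is_Cderive_eq; [apply is_Cderive_scal, is_Cderive_id | simpl; ring]. Qed.

(** For f = z exp G one has f' = exp G (1 + z G'), so z f' / f = psi becomes 1 + z G' = psi. The
    removable singularity of (psi - 1) / z makes this equation solvable on the whole disk. *)
Lemma extremal_function (phi : C -> C) :
  analytic_on_disk phi -> (forall z, in_disk z -> 0 < Re (phi z)) -> phi (RtoC 0) = RtoC 1 ->
  exists f, class_S f /\ forall z, in_disk z -> starlike_quotient f z = phi (Ci * z)%C.
Proof.
  intros Hphi Hpos phi0. set (psi := fun z => phi (Ci * z)%C).
  assert (Hpsi : analytic_on_disk psi).
  { intros z Hz. eexists. apply (is_Cderive_comp phi (fun x => Ci * x)%C).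
    - apply analytic_is_Cderive; [exact Hphi | apply rotation_in_disk, Hz].
    - apply is_Cderive_rotation. }
  assert (psi0 : psi (RtoC 0) = RtoC 1) by (unfold psi; rewrite Cmult_0_r; exact phi0).
  set (h := diff_quot psi (RtoC 0)).
  assert (Hh := analytic_diff_quot_0 psi Hpsi). fold h in Hh.
  assert (Eh : forall z, (RtoC 1 + z * h z)%C = psi z).
  { intros z. assert (M := diff_quot_mult psi (RtoC 0) z). fold h in M. rewrite psi0 in M.
    replace (z - RtoC 0)%C with z in M by ring. rewrite M. ring. }
  destruct (disk_primitive h (RtoC 0)) as [G0 HG0].
  { intros z Hz. apply analytic_continuous; assumption. }
  { intros z Hz _. apply Hh, Hz. }
  (* Normalised by G(0) = 0, which yields f'(0) = 1. *)
  set (G := fun z => (G0 z - G0 (RtoC 0))%C).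
  assert (HG : forall z, in_disk z -> is_Cderive G z (h z)).
  { intros z Hz. eapply is_Cderive_eq.
    - apply is_Cderive_minus; [apply HG0, Hz | apply is_Cderive_const].
    - ring. }
  set (f := fun z : C => (z * Cexp (G z))%C).
  assert (Hf : forall z, in_disk z -> is_Cderive f z (Cexp (G z) * psi z)%C).
  { intros z Hz. eapply is_Cderive_eq.
    - apply is_Cderive_mult; [apply is_Cderive_id|].
      apply (is_Cderive_comp Cexp G); [apply is_Cderive_Cexp | apply HG, Hz].
    - rewrite <- Eh. simpl. ring. }
  assert (EG : Cexp (G (RtoC 0)) = RtoC 1).
  { unfold G. replace (G0 (RtoC 0) - G0 (RtoC 0))%C with (RtoC 0) by ring. apply Cexp_0. }
  exists f. split; [split; [split; [|split]|]|].
  - intros z Hz. eexists. apply Hf, Hz.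
  - rewrite taylor_coef_0. unfold f. ring.
  - rewrite taylor_coef_1, (C_derive_eq _ _ _ (Hf _ in_disk_0)), EG, psi0. ring.
  - apply (starlike_univalent psi G).
    + intros z Hz. apply Hpos, rotation_in_disk, Hz.
    + intros z Hz. exists (h z). auto.
  - intros z Hz. unfold starlike_quotient. fold (psi z). destruct Ceq_dec as [->|N].
    + symmetry; exact psi0.
    + rewrite (C_derive_eq _ _ _ (Hf _ Hz)). assert (Q := Cexp_neq_0 (G z)). unfold f. field. auto.
Qed.

Theorem theorem2p3 :
  forall (phi : C -> C) (B1 B2 : R),
    analytic_on_disk phi ->
    univalent_on_disk phi ->
    (forall z : C, in_disk z -> 0 < Re (phi z)) ->
    phi (RtoC 0) = RtoC 1 ->
    Im (C_derive_n 1 phi (RtoC 0)) = 0 ->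
    0 < Re (C_derive_n 1 phi (RtoC 0)) ->
    Im (C_derive_n 2 phi (RtoC 0)) = 0 ->
    taylor_coef phi 1 = RtoC B1 ->
    taylor_coef phi 2 = RtoC B2 ->
    0 < B1 ->
    B1 - B1 ^ 2 <= B2 ->
    B2 <= 3 * B1 ^ 2 - B1 ->
    (forall f : C -> C,
       class_S_star phi f ->
       Cmod (toeplitz_det f 3 1)
         <= 1 + 2 * B1 ^ 2 + 1 / 4 * (B2 + B1 ^ 2) * (3 * B1 ^ 2 - B2)) /\
    (exists f : C -> C,
       class_S_star phi f /\
       Cmod (toeplitz_det f 3 1)
         = 1 + 2 * B1 ^ 2 + 1 / 4 * (B2 + B1 ^ 2) * (3 * B1 ^ 2 - B2)).
Proof.
  intros phi B1 B2 Hphi _ Hpos phi0 _ _ _ E1 E2 HB1 L1 L2. split.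
  { intros f. apply toeplitz_bound; assumption. }
  destruct (extremal_function phi Hphi Hpos phi0) as [f [HS Hq]].
  assert (Hw : analytic_on_disk (fun z => Ci * z)%C).
  { intros z _. eexists. apply is_Cderive_rotation. }
  assert (w0 : (Ci * RtoC 0)%C = RtoC 0) by ring.
  exists f. split.
  { split; [exact HS|]. exists (fun z => Ci * z)%C.
    split; [exact Hw | split; [exact rotation_in_disk | split; [exact w0 | exact Hq]]]. }
  destruct (starlike_coefs phi f (fun z => Ci * z)%C Hphi phi0 HS Hw rotation_in_disk w0 Hq) as [A2 A3].
  assert (c1 : taylor_coef (fun z => Ci * z)%C 1 = Ci).
  { rewrite taylor_coef_1. apply C_derive_eq, is_Cderive_rotation. }
  assert (c2 : taylor_coef (fun z => Ci * z)%C 2 = RtoC 0).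
  { rewrite taylor_coef_2. rewrite (C_derive_eq _ _ (RtoC 0)); [field|].
    apply (is_Cderive_disk_ext (fun _ => Ci)); [|apply in_disk_0 | apply is_Cderive_const].
    intros z _. symmetry. apply C_derive_eq, is_Cderive_rotation. }
  assert (i2 : (Ci * Ci)%C = RtoC (-1)) by (unfold Cmult, Ci, RtoC; simpl; f_equal; ring).
  rewrite c1, E1 in A2. rewrite c1, c2, i2, E1, E2 in A3.
  rewrite toeplitz_det_3_1 by exact (proj2 (proj2 (proj1 HS))). rewrite A3, A2.
  (* Since c1^2 = -1 and c2 = 0: a2^2 = - B1^2, a3 = - (B2 + B1^2) / 2 and 2 a2^2 - a3 = - (3 B1^2 -
     B2) / 2, so the determinant is real. *)
  replace (RtoC B1 * Ci * (RtoC B1 * Ci))%C with (RtoC B1 * RtoC B1 * RtoC (-1))%C by (rewrite <- i2; ring).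
  match goal with |- Cmod ?X = ?r => replace X with (RtoC r) end.
  (* The value is positive, since B2 + B1^2 and 3 B1^2 - B2 are both at least B1 > 0. *)
  - rewrite Cmod_R. apply Rabs_pos_eq. nra.
  - apply injective_projections; simpl; field.
Qed.
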